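(* Let $d\ge3$ and $0<\alpha<1$. For a bounded domain $\Omega\subset\mathbb{R}^d$ consider the condition $$(\ast)\qquad \mathrm{II}_{\partial\Omega}\ \ge\ (1-\alpha)\,\frac{x\cdot\nu}{|x|^2}\qquad\text{at every }x\in\partial\Omega,$$ where $\mathrm{II}_{\partial\Omega}$ and $\nu$ denote the second fundamental form of $\partial\Omega$ and the unit outward normal to $\Omega$ at $x$. Let $O$ denote the origin. (i) If $\Omega\subset\mathbb{R}^d$ is a bounded domain satisfying $(\ast)$ and $O\in\Omega$, then $\Omega$ is convex. (ii) Among the bounded domains $\Omega\subset\mathbb{R}^d$ with $O\in\mathbb{R}^d\setminus\overline\Omega$ there exist both convex and nonconvex ones satisfying $(\ast)$.
   Context: The inequality $(\ast)$ is meant in the sense of quadratic forms: $\mathrm{II}_{\partial\Omega}(X,X)\ge(1-\alpha)\frac{x\cdot\nu}{|x|^2}|X|^2$ for every $X$ tangent to $\partial\Omega$ at $x$. The sign of the second fundamental form is $\mathrm{II}(X,Y)=\langle D_X\nu,Y\rangle$ with $\nu$ the outward unit normal, so that balls have positive second fundamental form. Domains are open and connected, with smooth boundary, so that $\mathrm{II}_{\partial\Omega}$ is defined. *)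

(* Defs.v *)
From HB Require Import structures.
From mathcomp Require Import all_boot all_order all_algebra.
From mathcomp Require Import all_classical all_reals all_analysis.

Set Implicit Arguments.
Unset Strict Implicit.
Unset Printing Implicit Defensive.

Import Order.TTheory GRing.Theory Num.Theory.
Import numFieldNormedType.Exports.

Local Open Scope classical_set_scope.
Local Open Scope ring_scope.

(* The library norm `|x| on 'rV[R]_d is the sup norm.  It induces the usual
   topology and the usual bounded sets, and is used only for these; metric
   quantities use the Euclidean inner product below. *)
Definition dotv (R : realType) (d : nat) (u v : 'rV[R]_d) : R :=
  \sum_(i < d) u 0 i * v 0 i.

Definition enorm (R : realType) (d : nat) (u : 'rV[R]_d) : R :=
  Num.sqrt (dotv u u).

Definition partial (R : realType) (d : nat) (i : 'I_d) (g : 'rV[R]_d -> R) :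
    'rV[R]_d -> R :=
  fun y => 'D_(delta_mx 0 i) g y.

(* C^oo on U: all partial derivatives of all orders (the empty list s gives g
   itself) are Frechet differentiable, hence continuous, at each point of U. *)
Definition smooth_on (R : realType) (d : nat) (U : set 'rV[R]_d)
    (g : 'rV[R]_d -> R) : Prop :=
  forall (s : seq 'I_d) (y : 'rV[R]_d), U y ->
    differentiable (foldr (@partial R d) g s) y.

Definition grad (R : realType) (d : nat) (g : 'rV[R]_d -> R) (y : 'rV[R]_d) :
    'rV[R]_d :=
  \row_(i < d) partial i g y.

Definition frontier (T : topologicalType) (A : set T) : set T :=
  closure A `\` interior A.

(* Near x, Omega is the sublevel set {g < 0} of a smooth function without
   critical points; so, near x, the boundary of Omega is the smooth hypersurface
   {g = 0}, Omega lies on one side of it, and grad g points out of Omega. *)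
Definition defining_function (R : realType) (d : nat) (Omega : set 'rV[R]_d)
    (x : 'rV[R]_d) (g : 'rV[R]_d -> R) : Prop :=
  exists U : set 'rV[R]_d,
    [/\ open_nbhs x U,
        smooth_on U g,
        (forall y, U y -> grad g y != 0) &
        (forall y, U y -> (Omega y <-> g y < 0))].

Definition smooth_boundary (R : realType) (d : nat) (Omega : set 'rV[R]_d) :
    Prop :=
  forall x, frontier Omega x -> exists g, defining_function Omega x g.

Definition bounded_domain (R : realType) (d : nat) (Omega : set 'rV[R]_d) :
    Prop :=
  [/\ Omega !=set0, open Omega, connected Omega, bounded_set Omega &
      smooth_boundary Omega].

Definition unit_grad (R : realType) (d : nat) (g : 'rV[R]_d -> R)
    (y : 'rV[R]_d) : 'rV[R]_d :=
  (enorm (grad g y))^-1 *: grad g y.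

(* Some defining function of Omega at x.  The choice is immaterial: if g is any
   defining function at x, then unit_grad g is, at the points of the boundary
   near x, the outward unit normal, so that neither outer_normal nor, for X
   tangent to the boundary, second_form below depends on it. *)
Definition local_defining (R : realType) (d : nat) (Omega : set 'rV[R]_d)
    (x : 'rV[R]_d) : 'rV[R]_d -> R :=
  xget (fun=> 0) [set g | defining_function Omega x g].

Definition outer_normal (R : realType) (d : nat) (Omega : set 'rV[R]_d)
    (x : 'rV[R]_d) : 'rV[R]_d :=
  unit_grad (local_defining Omega x) x.

Definition tangent (R : realType) (d : nat) (Omega : set 'rV[R]_d)
    (x X : 'rV[R]_d) : Prop :=
  dotv X (outer_normal Omega x) = 0.

(* II(X, Y) = <D_X nu, Y>, where nu is extended to a neighbourhood of x as the
   normalized gradient of a defining function. *)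
Definition second_form (R : realType) (d : nat) (Omega : set 'rV[R]_d)
    (x X Y : 'rV[R]_d) : R :=
  dotv ('D_X (unit_grad (local_defining Omega x)) x) Y.

(* When x = 0 lies on the boundary the quotient is 0 by convention; this case
   does not arise for domains with 0 in Omega or 0 outside closure Omega. *)
Definition II_lower_bound (R : realType) (d : nat) (alpha : R)
    (Omega : set 'rV[R]_d) : Prop :=
  forall x, frontier Omega x -> forall X, tangent Omega x X ->
    second_form Omega x X X >=
      (1 - alpha) * (dotv x (outer_normal Omega x) / enorm x ^+ 2)
        * enorm X ^+ 2.

(* Main.v *)
Require Import Defs.
From HB Require Import structures.
From mathcomp Require Import all_boot all_order all_algebra.
From mathcomp Require Import all_classical all_reals all_analysis.
From mathcomp Require Import ring lra.

Set Implicit Arguments.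
Unset Strict Implicit.
Unset Printing Implicit Defensive.

Import Order.TTheory GRing.Theory Num.Theory.
Import numFieldNormedType.Exports.

Local Open Scope classical_set_scope.
Local Open Scope ring_scope.

(** Part (i).  The lower bound (CC) on the second fundamental form says that the
    boundary is weakly convex for the conformal metric
    [|x|^(2 (alpha - 1)) |dx|^2], a cone with vertex at the origin whose
    geodesics through the vertex are the Euclidean rays.  So the domain, being
    connected and containing the vertex, should be star-shaped
    about it; then [x . nu >= 0] on the boundary, the second fundamental form is
    nonnegative, and the domain is convex.  Both steps are the same classical
    argument.  The set of points joined to [p] by a segment inside the domain is
    open; it is closed in the domain unless some segment in the closure touches
    the boundary at a point [z] between its ends ([star_shaped_connected]).  Along such
    a segment, in the direction [X], a local defining function [g] restricts to
    [phi <= 0] with [phi = phi' = 0] at the touching time, and the curvature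
    condition gives [phi'' >= - C (|phi'| + |phi|)] ([hess_lower_bound]).  Hence
    [phi = 0] just before the touching time ([second_order_vanish]): the segment
    was in the boundary already, which contradicts that [z] is the first contact
    ([touching_segment], [star_shaped]).  In the first step [p = 0]: the segment
    is radial, so [z] is a multiple of [X] and the right-hand side of (CC),
    being proportional to [z . nu], is controlled by [phi' = X . grad g].  In the
    second step [p] is arbitrary and the right-hand side is replaced by 0.

    The inequality for [phi''] is known only at boundary points and for tangent
    vectors.  It is transported to nearby points because all quantities are
    locally Lipschitz and the distance from [y] to the boundary is [O (|g y|)]
    ([dist_zero_set]), and to [X] because [X] differs from a tangent vector by a
    multiple of [X . grad g].

    The second fundamental form is defined through an unspecified defining
    function.  Two defining functions at the same point have proportional
    gradients and, on tangent vectors, proportional Hessians with the same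
    factor ([boundary_form_indep]): a parabola that bends into the sublevel set
    of one of them, to second order, enters that of the other
    ([second_order_compare]).

    Part (ii).  With [w = x - 8 e] for a unit coordinate vector [e] and
    [q = |w|^2], take the domain [q^2 - b q / 2 - w . e < 0].  It is convex for
    [b = 0].  For [b > 0] its boundary bends the wrong way at [w = 0], where the
    outward normal [- e] points to the origin: the curvature there is [- b],
    and (CC) allows [- (1 - alpha) / 8].  Away from [w = 0] the quartic term
    dominates, and [b = (1 - alpha) / 10] satisfies (CC) everywhere
    ([quartic_boundary_form]). *)

(** * Inner product, gradient and Hessian *)

Section InnerProduct.
Context {R : realType} {d : nat}.
Implicit Types (u v w : 'rV[R]_d) (a : R).

Lemma dotvC u v : dotv u v = dotv v u.
Proof. by apply: eq_bigr => i _; rewrite mulrC. Qed.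

Lemma dotvDl u v w : dotv (u + v) w = dotv u w + dotv v w.
Proof. by rewrite /dotv -big_split; apply: eq_bigr => i _; rewrite mxE mulrDl. Qed.

Lemma dotvZl a u v : dotv (a *: u) v = a * dotv u v.
Proof. by rewrite /dotv mulr_sumr; apply: eq_bigr => i _; rewrite mxE mulrA. Qed.

Lemma dotvDr u v w : dotv u (v + w) = dotv u v + dotv u w.
Proof. by rewrite dotvC dotvDl !(dotvC u). Qed.

Lemma dotvZr a u v : dotv u (a *: v) = a * dotv u v.
Proof. by rewrite dotvC dotvZl dotvC. Qed.

Lemma dotvNl u v : dotv (- u) v = - dotv u v.
Proof. by rewrite -scaleN1r dotvZl mulN1r. Qed.

Lemma dotvNr u v : dotv u (- v) = - dotv u v.
Proof. by rewrite dotvC dotvNl dotvC. Qed.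

Lemma dotv0l u : dotv 0 u = 0.
Proof. by rewrite /dotv big1 // => i _; rewrite mxE mul0r. Qed.

Lemma dotv_ge0 u : 0 <= dotv u u.
Proof. by apply: sumr_ge0 => i _; rewrite -expr2 sqr_ge0. Qed.

Lemma dotv_eq0 u : (dotv u u == 0) = (u == 0).
Proof.
apply/eqP/eqP => [u0|->]; last exact: dotv0l.
apply/rowP => i; rewrite mxE; apply/eqP; rewrite -sqrf_eq0 expr2.
have /psumr_eq0P H : forall j, true -> 0 <= u 0 j * u 0 j.
  by move=> j _; rewrite -expr2 sqr_ge0.
by rewrite (H u0).
Qed.

Lemma dotv_gt0 u : (0 < dotv u u) = (u != 0).
Proof. by rewrite lt_def dotv_ge0 andbT dotv_eq0. Qed.

Lemma enorm_sqr u : enorm u ^+ 2 = dotv u u.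
Proof. by rewrite /enorm sqr_sqrtr ?dotv_ge0. Qed.

Lemma enorm_gt0 u : (0 < enorm u) = (u != 0).
Proof. by rewrite /enorm sqrtr_gt0 dotv_gt0. Qed.

End InnerProduct.

Section SecondDerivatives.
Context {R : realType} {d : nat}.
Implicit Types (x y z u v w X : 'rV[R]_d) (f g : 'rV[R]_d -> R)
  (U : set 'rV[R]_d).

(** The row in this formula is the derivative of [grad f] in the direction
    [v]. *)
Definition hess f y u v : R :=
  dotv u (\row_i dotv v (grad (partial i f) y)).

Lemma hessDl f y u v w : hess f y (u + v) w = hess f y u w + hess f y v w.
Proof. exact: dotvDl. Qed.

Lemma hessZl f y (a : R) u w : hess f y (a *: u) w = a * hess f y u w.
Proof. exact: dotvZl. Qed.

Lemma hessDr f y u v w : hess f y w (u + v) = hess f y w u + hess f y w v.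
Proof.
by rewrite /hess -dotvDr; congr dotv; apply/rowP => i; rewrite !mxE dotvDl.
Qed.

Lemma hessZr f y (a : R) u w : hess f y w (a *: u) = a * hess f y w u.
Proof.
by rewrite /hess -dotvZr; congr dotv; apply/rowP => i; rewrite !mxE dotvZl.
Qed.

Lemma smooth_on_differentiable U f y :
  smooth_on U f -> U y -> differentiable f y.
Proof. by move=> sf Uy; exact: (sf [::] y Uy). Qed.

Lemma smooth_on_partial U f i : smooth_on U f -> smooth_on U (partial i f).
Proof. by move=> sf s y Uy; have := sf (rcons s i) y Uy; rewrite foldr_rcons. Qed.

Lemma derive_grad f y v : differentiable f y -> 'D_v f y = dotv v (grad f y).
Proof.
move=> df; rewrite deriveE // {1}[v]row_sum_delta linear_sum.
by apply: eq_bigr => i _; rewrite linearZ /= mxE /partial deriveE.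
Qed.

Lemma is_derive_along f (c : R -> 'rV[R]_d) (t : R) v :
  is_derive t 1 c v -> differentiable f (c t) ->
  is_derive t 1 (fun s => f (c s)) (dotv v (grad f (c t))).
Proof.
move=> [dc cv] df.
have dc' : differentiable c t by exact/derivable1_diffP.
have dfc : differentiable (f \o c) t by exact: differentiable_comp.
apply: DeriveDef; first exact: diff_derivable.
rewrite -derive_grad // deriveE // -/(f \o c) deriveE// diff_comp //=.
by rewrite -(deriveE _ dc') cv.
Qed.

Lemma is_derive_parabola z X B (t : R) :
  is_derive t 1 (fun s : R => z + s *: X + s ^+ 2 *: B) (X + (2 * t) *: B).
Proof.
have dl u : is_derive t 1 (fun s : R => s *: u) u.
  have ds : differentiable (fun s : R => s *: u) t.
    exact: differentiableZl.
  apply: DeriveDef; first exact: diff_derivable.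
  by rewrite deriveE // (diffZl _ _) //= diff_val /= scale1r.
have dq : is_derive t 1 (fun s : R => s ^+ 2 *: B) ((2 * t) *: B).
  have ds : differentiable (fun s : R => s ^+ 2) t.
    by apply/derivable1_diffP; exact: exprn_derivable.
  apply: DeriveDef; first exact/diff_derivable/differentiableZl.
  rewrite deriveE ?(diffZl _ _) //=; last exact/differentiableZl.
  by rewrite -deriveE // exp_derive expr1 /GRing.scale /= mulr1 -mulr_natl.
have H := is_deriveD (is_deriveD (is_derive_cst z t 1) (dl X)) dq.
by apply: is_derive_eq; rewrite add0r.
Qed.

Lemma is_derive_line f z X (t : R) : differentiable f (z + t *: X) ->
  is_derive t 1 (fun s => f (z + s *: X)) (dotv X (grad f (z + t *: X))).
Proof.
move=> df.
have := is_derive_parabola z X 0 t; rewrite scaler0 addr0.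
have -> : (fun s : R => z + s *: X + s ^+ 2 *: 0) = (fun s => z + s *: X).
  by apply/funext => s; rewrite scaler0 addr0.
by move=> dc; exact: is_derive_along.
Qed.

End SecondDerivatives.

(** * Independence of the defining function *)

Section SignTests.
Context {R : realType}.
Implicit Types (p q : R -> R).

Lemma is_derive_incr_right p (a l : R) : is_derive a 1 p l -> 0 < l ->
  exists2 e : R, 0 < e & forall t, 0 < t -> t < e -> p a < p (a + t).
Proof.
move=> [dp pl] l0.
have /cvgrPdist_lt/(_ _ l0)[e /= e0 He] := dp.
exists e => // t t0 te.
have := He t; rewrite /= sub0r normrN (gtr0_norm t0) => /(_ te).
rewrite gt_eqF // => /(_ isT).
rewrite [X in X - _](_ : _ = l); last exact: pl.
rewrite /GRing.scale /= mulr1 (addrC t) => /ltr_normlP[_].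
by rewrite ltrBlDl ltrDr pmulr_rgt0 ?invr_gt0 // subr_gt0.
Qed.

Lemma is_derive_pos_right p (l : R) : p 0 = 0 -> is_derive (0 : R) 1 p l ->
  0 < l -> exists2 e : R, 0 < e & forall t, 0 < t -> t < e -> 0 < p t.
Proof.
move=> p0 dp /(is_derive_incr_right dp)[e e0 He].
by exists e => // t t0 te; have := He t t0 te; rewrite p0 add0r.
Qed.

Lemma is_derive2_pos_right p q (e l : R) : 0 < e ->
  (forall t, 0 <= t -> t < e -> is_derive t 1 p (q t)) ->
  p 0 = 0 -> q 0 = 0 -> is_derive (0 : R) 1 q l -> 0 < l ->
  exists2 e : R, 0 < e & forall t, 0 < t -> t < e -> 0 < p t.
Proof.
move=> e0 pq p0 q0 dq l0.
have [e' e'0 qpos] := is_derive_pos_right q0 dq l0.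
exists (Num.min e e'); first by rewrite lt_min e0.
move=> t t0; rewrite lt_min => /andP[te te'].
have [| |c] := @MVT _ p q 0 t t0.
- move=> s; rewrite in_itv /= => /andP[s0 st].
  by apply: pq; [exact: ltW|exact: lt_trans te].
- apply: derivable_within_continuous => s; rewrite in_itv /= => /andP[s0 st].
  by have [] := pq s s0 (le_lt_trans st te).
rewrite in_itv /= => /andP[c0 ct]; rewrite p0 !subr0 => ->.
by rewrite mulr_gt0 // qpos // (lt_trans ct).
Qed.

Lemma is_derive_neg_right p (l : R) : p 0 = 0 -> is_derive (0 : R) 1 p l ->
  l < 0 -> exists2 e : R, 0 < e & forall t, 0 < t -> t < e -> p t < 0.
Proof.
move=> p0 dp l0; have [| |e e0 He] := @is_derive_pos_right (- p) (- l).
- by rewrite fctE p0 oppr0.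
- by rewrite oppr_gt0.
by exists e => // t t0 te; rewrite -oppr_gt0; exact: He.
Qed.

Lemma is_derive2_neg_right p q (e l : R) : 0 < e ->
  (forall t, 0 <= t -> t < e -> is_derive t 1 p (q t)) ->
  p 0 = 0 -> q 0 = 0 -> is_derive (0 : R) 1 q l -> l < 0 ->
  exists2 e : R, 0 < e & forall t, 0 < t -> t < e -> p t < 0.
Proof.
move=> e0 pq p0 q0 dq l0.
have [| | | |e' e'0 He] := @is_derive2_pos_right (- p) (- q) e (- l) e0.
- by move=> t t0 te; apply: is_deriveN; exact: pq.
- by rewrite fctE p0 oppr0.
- by rewrite fctE q0 oppr0.
- by rewrite oppr_gt0.
by exists e' => // t t0 te; rewrite -oppr_gt0; exact: He.
Qed.

End SignTests.

Section Comparison.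
Context {R : realType} {d : nat}.
Implicit Types (x y z u v w X B : 'rV[R]_d) (f g : 'rV[R]_d -> R)
  (U Omega : set 'rV[R]_d).

Lemma parabola_nbhs x X B (A : set 'rV[R]_d) : nbhs x A ->
  exists2 e : R, 0 < e & forall t : R, `|t| < e -> A (x + t *: X + t ^+ 2 *: B).
Proof.
move=> Ax.
have c : {for 0, continuous (fun s : R => x + s *: X + s ^+ 2 *: B)}.
  apply: differentiable_continuous; apply/derivable1_diffP.
  by have [] := is_derive_parabola x X B 0.
have : nbhs ((fun s : R => x + s *: X + s ^+ 2 *: B) 0) A.
  by rewrite expr0n /= !scale0r !addr0.
move/c => -[e /= e0 He]; exists e => // t te; apply: He => /=.
by rewrite sub0r normrN.
Qed.

Lemma line_nbhs x X (A : set 'rV[R]_d) : nbhs x A ->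
  exists2 e : R, 0 < e & forall t : R, `|t| < e -> A (x + t *: X).
Proof.
move=> /(parabola_nbhs X 0)[e e0 He]; exists e => // t /He.
by rewrite scaler0 addr0.
Qed.

Lemma is_derive_parabola2 U f x X B : smooth_on U f -> U x ->
  is_derive (0 : R) 1
    (fun t : R => dotv (X + (2 * t) *: B) (grad f (x + t *: X + t ^+ 2 *: B)))
    (hess f x X X + 2 * dotv B (grad f x)).
Proof.
move=> sf Ux.
have dlin i : is_derive (0 : R) 1 (fun t : R => (X + (2 * t) *: B) 0 i) (2 * B 0 i).
  have -> : (fun t : R => (X + (2 * t) *: B) 0 i)
      = cst (X 0 i) + (2 * B 0 i) *: id.
    apply/funext => t; rewrite !mxE /= /GRing.scale /=.
    by rewrite fctE /= /cst /GRing.scale /=; ring.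
  have := is_deriveD (is_derive_cst (X 0 i) (0 : R) 1)
    (is_deriveZ (2 * B 0 i) (is_derive_id (0 : R) 1)).
  by rewrite add0r /GRing.scale /= mulr1.
have dpar i : is_derive (0 : R) 1
    (fun t : R => partial i f (x + t *: X + t ^+ 2 *: B))
    (dotv X (grad (partial i f) x)).
  have H0 : x + 0 *: X + 0 ^+ 2 *: B = x.
    by rewrite expr0n /= !scale0r !addr0.
  have := @is_derive_along _ _ (partial i f)
    (fun t : R => x + t *: X + t ^+ 2 *: B) 0 X.
  rewrite H0; apply.
    have := is_derive_parabola x X B 0.
    by rewrite mulr0 scale0r addr0.
  by apply: smooth_on_differentiable Ux; exact: smooth_on_partial.
have := is_derive_sum (fun i => is_deriveM (dlin i) (dpar i)).
have -> : \sum_(i < d) ((fun t : R => (X + (2 * t) *: B) 0 i) *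
    (fun t : R => partial i f (x + t *: X + t ^+ 2 *: B))) =
  (fun t => dotv (X + (2 * t) *: B) (grad f (x + t *: X + t ^+ 2 *: B))).
  apply/funext => t; rewrite fct_sumE /dotv; apply: eq_bigr => i _.
  by rewrite [grad f _ 0 i]mxE.
move=> H; apply: is_derive_eq.
rewrite /hess /dotv mulr_sumr -big_split /=; apply: eq_bigr => i _.
rewrite !mxE mulr0 mul0r addr0 expr0n /= !scale0r !addr0 /GRing.scale /=.
by rewrite /dotv; ring.
Qed.

Definition on_parabola f x X B (t : R) := f (x + t *: X + t ^+ 2 *: B).

Lemma parabola_second_order U f x X B : open_nbhs x U -> smooth_on U f ->
  exists q : R -> R, exists2 e : R, 0 < e &
  [/\ forall t : R, 0 <= t -> t < e -> is_derive t 1 (on_parabola f x X B) (q t),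
      q 0 = dotv X (grad f x) &
      is_derive (0 : R) 1 q (hess f x X X + 2 * dotv B (grad f x))].
Proof.
move=> xU sf.
have Ux : U x by case: xU.
have [e e0 He] := parabola_nbhs X B (open_nbhs_nbhs xU).
exists (fun t => dotv (X + (2 * t) *: B) (grad f (x + t *: X + t ^+ 2 *: B))).
exists e => //; split.
- move=> t t0 te; apply: is_derive_along; first exact: is_derive_parabola.
  by apply: smooth_on_differentiable sf _; apply: He; rewrite ger0_norm.
- by rewrite expr0n /= mulr0 !scale0r !addr0.
- exact: (is_derive_parabola2 X B sf Ux).
Qed.

Lemma on_parabola0 f x X B : on_parabola f x X B 0 = f x.
Proof. by rewrite /on_parabola expr0n /= !scale0r !addr0. Qed.

(** For [X] tangent to both zero sets, the quantity compared is the second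
    derivative at 0 along the parabola [x + t X + t^2 B]: if it is negative for
    [f], the parabola enters the sublevel set of [f], hence that of [g]. *)
Lemma second_order_compare U f g x X B : open_nbhs x U ->
  smooth_on U f -> smooth_on U g -> f x = 0 -> g x = 0 ->
  (\forall y \near x, f y < 0 -> g y < 0) ->
  dotv X (grad f x) = 0 -> dotv X (grad g x) = 0 ->
  hess f x X X + 2 * dotv B (grad f x) < 0 ->
  hess g x X X + 2 * dotv B (grad g x) <= 0.
Proof.
move=> xU sf sg f0 g0 fg Xf Xg Hf; rewrite leNgt; apply/negP => Hg.
have [e1 e10 H1] := parabola_nbhs X B fg.
have [p [e ep [dp p0 dp0]]] := parabola_second_order X B xU sf.
have [q [e' eq [dq q0 dq0]]] := parabola_second_order X B xU sg.
have [| |e2 e20 H2] := is_derive2_neg_right ep dp _ _ dp0 Hf.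
- by rewrite on_parabola0.
- by rewrite p0.
have [| |e3 e30 H3] := is_derive2_pos_right eq dq _ _ dq0 Hg.
- by rewrite on_parabola0.
- by rewrite q0.
pose m := Num.min e1 (Num.min e2 e3).
have m0 : 0 < m by rewrite /m !lt_min e10 e20.
have t0 : 0 < m / 2 by rewrite divr_gt0.
have : m / 2 < m by rewrite ltr_pdivrMr // ltr_pMr // ltr1n.
rewrite {2}/m !lt_min => /and3P[te1 te2 te3].
have := H1 (m / 2); rewrite gtr0_norm // => /(_ te1 (H2 _ t0 te2)).
by rewrite ltNge ltW // H3.
Qed.

Lemma first_order_compare U f g x V : open_nbhs x U ->
  smooth_on U f -> smooth_on U g -> f x = 0 -> g x = 0 ->
  (\forall y \near x, f y < 0 -> g y < 0) ->
  dotv V (grad f x) < 0 -> dotv V (grad g x) <= 0.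
Proof.
move=> xU sf sg f0 g0 fg Hf; rewrite leNgt; apply/negP => Hg.
have [e1 e10 H1] := parabola_nbhs V 0 fg.
have [p [e ep [dp p0 _]]] := parabola_second_order V 0 xU sf.
have [q [e' eq [dq q0 _]]] := parabola_second_order V 0 xU sg.
have := dp _ (lexx 0) ep; rewrite p0 => {}dp.
have := dq _ (lexx 0) eq; rewrite q0 => {}dq.
have [|e2 e20 H2] := is_derive_neg_right _ dp Hf; first by rewrite on_parabola0.
have [|e3 e30 H3] := is_derive_pos_right _ dq Hg; first by rewrite on_parabola0.
pose m := Num.min e1 (Num.min e2 e3).
have m0 : 0 < m by rewrite /m !lt_min e10 e20.
have t0 : 0 < m / 2 by rewrite divr_gt0.
have : m / 2 < m by rewrite ltr_pdivrMr // ltr_pMr // ltr1n.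
rewrite {2}/m !lt_min => /and3P[te1 te2 te3].
have := H1 (m / 2); rewrite gtr0_norm // => /(_ te1 (H2 _ t0 te2)).
by rewrite ltNge ltW // H3.
Qed.

(** By [first_order_compare] the open half space [V . grad f < 0] is contained
    in [V . grad g <= 0], which forces the two normals to agree. *)
Lemma grad_collinear U f g x : open_nbhs x U ->
  smooth_on U f -> smooth_on U g -> f x = 0 -> g x = 0 ->
  (\forall y \near x, f y < 0 -> g y < 0) ->
  grad f x != 0 -> grad g x != 0 ->
  exists2 c : R, 0 < c & grad g x = c *: grad f x.
Proof.
move=> xU sf sg f0 g0 fg.
set N := grad f x; set M := grad g x => N0 M0.
have cmp V : dotv V N < 0 -> dotv V M <= 0 by exact: first_order_compare xU _ _ _ _ _.
have NN : 0 < dotv N N by rewrite dotv_gt0.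
pose c := dotv M N / dotv N N; pose W := M - c *: N.
have WN : dotv W N = 0.
  by rewrite dotvDl dotvNl dotvZl /c divfK ?subrr // gt_eqF.
have WM : dotv W M = dotv W W.
  by rewrite {3}/W dotvDr dotvNr dotvZr WN mulr0 subr0.
have W0 : W = 0.
  apply/eqP; rewrite -dotv_eq0 eq_le dotv_ge0 andbT.
  apply/ler_addgt0Pl => e e0; rewrite addr0.
  (* test W against the direction W - s N, with s so small that s (N . M) <= e *)
  pose s := e / (`|dotv N M| + 1).
  have p0 : 0 < `|dotv N M| + 1 by rewrite ltr_wpDl.
  have s0 : 0 < s by rewrite divr_gt0.
  have : dotv (W - s *: N) M <= 0.
    by apply: cmp; rewrite dotvDl dotvNl dotvZl WN add0r oppr_lt0 mulr_gt0.
  rewrite dotvDl dotvNl dotvZl WM subr_le0 => /le_trans; apply.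
  rewrite (@le_trans _ _ (s * (`|dotv N M| + 1))) //.
    by rewrite ler_wpM2l ?ltW // ltr_pwDr // ?ler_norm.
  by rewrite /s divfK // gt_eqF.
have Mc : M = c *: N by apply/eqP; rewrite -subr_eq0 -/W W0.
exists c => //; rewrite lt_def; apply/andP; split.
  by apply: contraNneq M0 => c0; rewrite Mc c0 scale0r.
have := cmp (- N); rewrite !dotvNl oppr_lt0 oppr_le0 => /(_ NN).
by rewrite Mc dotvZr pmulr_lge0.
Qed.

(** The vector [B] of the parabola may be any multiple of [grad f]; the infimum
    over the multiples for which [second_order_compare] applies gives the
    bound. *)
Lemma hess_compare U f g x (c : R) X : open_nbhs x U ->
  smooth_on U f -> smooth_on U g -> f x = 0 -> g x = 0 ->
  (\forall y \near x, f y < 0 -> g y < 0) ->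
  grad f x != 0 -> 0 < c -> grad g x = c *: grad f x ->
  dotv X (grad f x) = 0 -> hess g x X X <= c * hess f x X X.
Proof.
move=> xU sf sg f0 g0 fg N0 c0 gc Xf.
have NN : 0 < dotv (grad f x) (grad f x) by rewrite dotv_gt0.
apply/ler_addgt0Pl => e e0.
(* this B gives f the second derivative - e / c along the parabola *)
have [B Bf] : exists B, 2 * dotv B (grad f x) = - (hess f x X X + e / c).
  exists ((- (hess f x X X + e / c) / (2 * dotv (grad f x) (grad f x)))
    *: grad f x).
  by rewrite dotvZl; field; rewrite !gt_eqF.
have ec : 0 < e / c by rewrite divr_gt0.
have := @second_order_compare U f g x X B xU sf sg f0 g0 fg Xf.
rewrite gc !dotvZr Xf mulr0 => /(_ erefl); rewrite (mulrCA 2) Bf => H.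
have cE : c * (e / c) = e by rewrite mulrCA divff ?mulr1 // gt_eqF.
have : hess g x X X + c * - (hess f x X X + e / c) <= 0 by apply: H; lra.
by rewrite mulrN mulrDr cE subr_le0 addrC.
Qed.

End Comparison.

Section BoundaryForm.
Context {R : realType} {d : nat}.
Implicit Types (x y z u v w X B : 'rV[R]_d) (f g : 'rV[R]_d -> R)
  (U Omega : set 'rV[R]_d).

Lemma open_frontier Omega x : open Omega ->
  frontier Omega x <-> closure Omega x /\ ~ Omega x.
Proof. by move=> /interior_id oO; rewrite /frontier oO. Qed.

Lemma closure_sublevel_le0 Omega U g y : open_nbhs y U ->
  (forall y, U y -> (Omega y <-> g y < 0)) -> {for y, continuous g} ->
  closure Omega y -> g y <= 0.
Proof.
move=> yU Og cg clO; rewrite leNgt; apply/negP => gy.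
have gp : \forall u \near y, 0 < g u by move: cg => /cvgr_gt; apply.
have [u [Ou [Uu]]] := clO _ (filterI (open_nbhs_nbhs yU) gp).
by rewrite ltNge ltW //; apply/Og.
Qed.

Lemma defining_vanish Omega x g : open Omega -> frontier Omega x ->
  defining_function Omega x g -> g x = 0.
Proof.
move=> oO /(open_frontier _ oO)[clx nOx] [U [xU sg _ Og]].
have Ux : U x by case: xU.
apply/eqP; rewrite eq_le; apply/andP; split.
  apply: closure_sublevel_le0 xU Og _ clx.
  by apply: differentiable_continuous; exact: smooth_on_differentiable sg Ux.
by rewrite leNgt; apply/negP => /(Og _ Ux).
Qed.

(** The bound on the second fundamental form of [g = 0], multiplied by
    [|grad g|]: for [X] tangent, [hess g x X X] is [|grad g| II(X, X)]. *)
Definition boundary_form (c : R) g x : Prop :=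
  forall X, dotv X (grad g x) = 0 ->
    c * (dotv x (grad g x) / dotv x x) * dotv X X <= hess g x X X.

(** Both gradients and both Hessians on the tangent space are proportional, by
    the same factor: this is why the second fundamental form is well defined. *)
Lemma boundary_form_indep Omega x f g (c : R) : open Omega ->
  frontier Omega x -> defining_function Omega x f ->
  defining_function Omega x g -> boundary_form c f x -> boundary_form c g x.
Proof.
move=> oO fx df dg H X Xg.
have f0 := defining_vanish oO fx df; have g0 := defining_vanish oO fx dg.
have [U [xU sf Nf Of]] := df; have [V [xV sg Ng Og]] := dg.
pose W := U `&` V.
have Wx : open_nbhs x W by exact: open_nbhsI.
have Ux : U x by case: xU.
have Vx : V x by case: xV.
have sfW : smooth_on W f by move=> s y [Uy _]; exact: sf.
have sgW : smooth_on W g by move=> s y [_ Vy]; exact: sg.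
have fg : \forall y \near x, f y < 0 -> g y < 0.
  by apply: filterS (open_nbhs_nbhs Wx) => y [Uy Vy] fy; apply/Og => //; exact/Of.
have gf : \forall y \near x, g y < 0 -> f y < 0.
  by apply: filterS (open_nbhs_nbhs Wx) => y [Uy Vy] fy; apply/Of => //; exact/Og.
have [a a0 ga] := grad_collinear Wx sfW sgW f0 g0 fg (Nf _ Ux) (Ng _ Vx).
have fa : grad f x = a^-1 *: grad g x.
  by rewrite ga scalerA mulVf ?scale1r // gt_eqF.
have Xf : dotv X (grad f x) = 0 by rewrite fa dotvZr Xg mulr0.
have := H X Xf; rewrite -(ler_pM2l a0).
have -> : a * (c * (dotv x (grad f x) / dotv x x) * dotv X X)
  = c * (dotv x (grad g x) / dotv x x) * dotv X X by rewrite ga dotvZr; ring.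
move=> /le_trans; apply.
have := hess_compare Wx sgW sfW g0 f0 gf (Ng _ Vx) _ fa Xg.
rewrite invr_gt0 => /(_ a0).
by rewrite mulrC -ler_pdivlMl // mulrC.
Qed.

(** The derivative of the factor [1 / |grad g|] multiplies [grad g], which is
    orthogonal to [X]; only the derivative of [grad g] contributes. *)
Lemma dotv_derive_unit_grad U g x X : smooth_on U g -> U x -> grad g x != 0 ->
  dotv X (grad g x) = 0 ->
  dotv ('D_X (unit_grad g) x) X = (enorm (grad g x))^-1 * hess g x X X.
Proof.
move=> sg Ux N0 Xg.
pose k y := (enorm (grad g y))^-1.
have dp i : differentiable (partial i g) x.
  by apply: smooth_on_differentiable Ux; exact: smooth_on_partial.
have dk : derivable k x X.
  apply: diff_derivable.
  have -> : k = (fun r : R => (Num.sqrt r)^-1) \o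
      (\sum_(i < d) (partial i g * partial i g)).
    apply/funext => y /=; rewrite /k /enorm fct_sumE /dotv.
    by congr (Num.sqrt _)^-1; apply: eq_bigr => i _; rewrite !mxE.
  apply: differentiable_comp.
    by apply: differentiable_sum => i; exact: differentiableM.
  have -> : (\sum_(i < d) partial i g * partial i g) x = dotv (grad g x) (grad g x).
    by rewrite fct_sumE /dotv; apply: eq_bigr => i _; rewrite !mxE.
  have NN : 0 < dotv (grad g x) (grad g x) by rewrite dotv_gt0.
  apply/derivable1_diffP; apply: derivableV.
    by rewrite gt_eqF // sqrtr_gt0.
  by have [] := is_derive1_sqrt NN.
have E i : (fun y => unit_grad g y 0 i) = k * partial i g.
  by apply/funext => y; rewrite !mxE.
have dE i : derivable (fun y => unit_grad g y 0 i) x X.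
  by rewrite E; apply: derivableM; [exact: dk|exact/diff_derivable/dp].
have -> : 'D_X (unit_grad g) x = \row_i 'D_X (fun y => unit_grad g y 0 i) x.
  rewrite derive_mx; first by apply/matrixP => i j; rewrite !mxE ord1.
  by apply/derivable_mxP => i j; rewrite ord1; exact: dE.
transitivity (k x * hess g x X X + 'D_X k x * dotv X (grad g x)).
  rewrite /hess dotvC /dotv !mulr_sumr -big_split; apply: eq_bigr => i _ /=.
  rewrite !mxE E (deriveM dk (diff_derivable (dp i))) (derive_grad _ (dp i)).
  rewrite -[\sum_(_ < d) _]/(dotv X (grad (partial i g) x)).
  by rewrite /GRing.scale /=; ring.
by rewrite Xg mulr0 addr0.
Qed.

Lemma local_definingP Omega x : smooth_boundary Omega -> frontier Omega x ->
  defining_function Omega x (local_defining Omega x).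
Proof. by move=> sO /sO[g dg]; apply: xgetPex; exists g. Qed.

(** One convenient defining function at each boundary point is enough. *)
Lemma II_lower_boundP (alpha : R) Omega :
  open Omega -> smooth_boundary Omega ->
  II_lower_bound alpha Omega <->
  forall x, frontier Omega x ->
    exists2 g, defining_function Omega x g & boundary_form (1 - alpha) g x.
Proof.
move=> oO sO.
have E x : frontier Omega x ->
    (forall X, tangent Omega x X -> second_form Omega x X X >=
      (1 - alpha) * (dotv x (outer_normal Omega x) / enorm x ^+ 2)
        * enorm X ^+ 2) <-> boundary_form (1 - alpha) (local_defining Omega x) x.
  move=> fx; have [U [xU sg Ng _]] := local_definingP sO fx.
  have Ux : U x by case: xU.
  set g := local_defining Omega x; have N0 := Ng _ Ux.
  have e0 : 0 < (enorm (grad g x))^-1 by rewrite invr_gt0 enorm_gt0.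
  rewrite /tangent /second_form /outer_normal -/g.
  have T X : dotv X (unit_grad g x) = 0 <-> dotv X (grad g x) = 0.
    rewrite /unit_grad dotvZr; split=> [/eqP|->]; last by rewrite mulr0.
    by rewrite mulf_eq0 gt_eqF //= => /eqP.
  have S X : dotv X (grad g x) = 0 ->
     ((1 - alpha) * (dotv x (unit_grad g x) / enorm x ^+ 2) * enorm X ^+ 2
       <= dotv ('D_X (unit_grad g) x) X) =
     ((1 - alpha) * (dotv x (grad g x) / dotv x x) * dotv X X <= hess g x X X).
    move=> Xg; rewrite (dotv_derive_unit_grad sg Ux N0 Xg) !enorm_sqr.
    rewrite -[RHS](ler_pM2l e0) /unit_grad dotvZr.
    by congr (_ <= _); ring.
  by split=> H X XT; have := H X; [rewrite S // T; exact|
    move/T: XT => XT; rewrite S //; exact].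
split=> [H x fx|H x fx].
  exists (local_defining Omega x); first exact: local_definingP.
  by apply/(E x fx); exact: H.
have [g dg Hg] := H x fx.
by apply/(E x fx); exact: (boundary_form_indep oO fx dg (local_definingP sO fx) Hg).
Qed.

End BoundaryForm.

(** * Star-shapedness by connectedness *)

Section StarShaped.
Context {R : realType} {d : nat}.
Implicit Types (p x y z X : 'rV[R]_d) (Omega : set 'rV[R]_d).

Lemma first_exit Omega p X : open Omega -> Omega p ->
  (exists2 t : R, 0 <= t & ~ Omega (p + t *: X)) ->
  exists t0 : R, [/\ 0 < t0, ~ Omega (p + t0 *: X) &
    forall t, 0 <= t -> t < t0 -> Omega (p + t *: X)].
Proof.
move=> oO Op [t1 t10 nO].
pose T := [set t : R | 0 <= t /\ ~ Omega (p + t *: X)].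
have lbT : lbound T 0 by move=> t [].
have hT : has_inf T by split; [exists t1|exists 0].
have nT : ~ Omega (p + inf T *: X).
  move=> Oi; have [e e0 He] := line_nbhs X (open_nbhs_nbhs (conj oO Oi)).
  have [t [t0 nt] te] := inf_adherent e0 hT.
  have it : inf T <= t by apply: ge_inf => //; exists 0.
  apply: nt; have := He (t - inf T); rewrite -addrA -scalerDl subrKC; apply.
  by rewrite ger0_norm ?subr_ge0 // ltrBlDl.
have i0 : 0 <= inf T by apply: lb_le_inf => //; exists t1.
exists (inf T); split=> //.
  rewrite lt_def i0 andbT; apply: contra_notN nT => /eqP ->.
  by rewrite scale0r addr0.
move=> t t0 ti; apply: contrapT => nt.
by have := @ge_inf _ T (ex_intro _ 0 lbT) t (conj t0 nt); rewrite leNgt ti.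
Qed.

(** The set of points joined to [p] by a segment in [Omega] is open and, by the
    hypothesis on segments in the closure, closed in [Omega]. *)
Lemma star_shaped_connected Omega p : open Omega -> connected Omega -> Omega p ->
  (forall y, Omega y ->
    (forall t : R, 0 <= t <= 1 -> closure Omega (p + t *: (y - p))) ->
    forall t : R, 0 <= t <= 1 -> Omega (p + t *: (y - p))) ->
  forall y, Omega y -> forall t : R, 0 <= t <= 1 -> Omega (p + t *: (y - p)).
Proof.
move=> oO cO Op H.
pose B := [set y | Omega y /\ forall t : R, 0 <= t <= 1 -> Omega (p + t *: (y - p))].
have ctsy (y : 'rV[R]_d) (t : R) :
    {for y, continuous (fun z : 'rV[R]_d => p + t *: (z - p))}.
  apply: differentiable_continuous.
  apply: differentiableD; first exact: differentiable_cst.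
  by apply: differentiableZ; apply: differentiableB; [|exact: differentiable_cst].
suff BO : B = Omega by move=> y; rewrite -{1}BO => -[].
apply: cO.
- exists p; split=> // t _; by rewrite subrr scaler0 addr0.
- exists B; last by apply/seteqP; split=> [y|y []//]; move=> yB; split=> //; case: yB.
  rewrite openE => y [Oy Hy].
  have := @segment_compact R 0 1; rewrite compact_near_coveringP => /(_ _ (nbhs y)
    (fun z t => Omega (p + t *: (z - p)))) Hc.
  have {}Hc : \forall z \near y, `[0, 1]%classic `<=` (fun t => Omega (p + t *: (z - p))).
    apply: Hc => t /=; rewrite in_itv /= => t01.
    have cts : {for (t, y), continuous (fun q : R * 'rV[R]_d => p + q.1 *: (q.2 - p))}.
      apply: cvgD; first exact: cvg_cst.
      apply: cvgZ; first exact: cvg_fst.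
      by apply: cvgB; [exact: cvg_snd|exact: cvg_cst].
    have /cts : nbhs (p + t *: (y - p)) Omega by apply: open_nbhs_nbhs; split=> //; exact: Hy.
    by [].
  apply: filterS (filterI (open_nbhs_nbhs (conj oO Oy)) Hc) => z [Oz Hz].
  by split=> // t t01; apply: Hz; rewrite /= in_itv.
- exists (closure B); first exact: closed_closure.
  apply/seteqP; split=> [y By|y [Oy By]].
    by split; [case: By|exact: subset_closure].
  split=> //; apply: H => // t t01 V HV.
  have [z [[Oz Hz] Vz]] := By _ (ctsy y t _ HV).
  by exists (p + t *: (z - p)); split=> //; exact: Hz.
Qed.

End StarShaped.

(** * A differential inequality *)

Section Vanishing.
Context {R : realType}.

(** Suppose [- M], with [M > 0], is the minimum of [p] on [-n, 0], attained at
    [a].  The mean value theorem gives a point where [p' >= M / n].  With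
    [h t = p' t + C (p t) + (C + 1) M t] one has [h > 0] there when [n] is
    small, [h 0 = 0], and [h' > 0] wherever [h > 0]; so there is no place
    for the maximum of [h] between that point and 0. *)
Lemma second_order_vanish (p p1 p2 : R -> R) (C e : R) : 0 < e -> 0 <= C ->
  (forall t, - e < t -> t <= 0 -> is_derive t 1 p (p1 t)) ->
  (forall t, - e < t -> t <= 0 -> is_derive t 1 p1 (p2 t)) ->
  (forall t, - e < t -> t <= 0 -> p t <= 0) ->
  (forall t, - e < t -> t <= 0 -> - C * (`|p1 t| + `|p t|) <= p2 t) ->
  p 0 = 0 -> p1 0 = 0 ->
  exists2 n : R, 0 < n & forall t, - n <= t -> t <= 0 -> p t = 0.
Proof.
move=> e0 C0 dp dp1 pN p2N p0 p10.
have C1 : 0 < 2 * C + 2 by lra.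
(* n is such that 1 / n > C + (C + 1) n *)
pose n := Num.min (e / 2) (Num.min 1 (2 * C + 2)^-1).
have n0 : 0 < n by rewrite /n !lt_min divr_gt0 // ltr01 invr_gt0 C1.
have ne : n < e.
  by rewrite /n gt_min ltr_pdivrMr // ltr_pMr // ltr1n.
have n1 : n <= 1 by rewrite /n !ge_min lexx orbT.
have nC : n * (2 * C + 2) <= 1.
  by rewrite -ler_pdivlMr // div1r /n !ge_min lexx !orbT.
have rng t : - n <= t -> - e < t by move=> ?; lra.
have cts (q q1 : R -> R) a b : (forall t, - e < t -> t <= 0 -> is_derive t 1 q (q1 t)) ->
    - n <= a -> b <= 0 -> {within `[a, b], continuous q}.
  move=> dq na b0; apply: derivable_within_continuous => t.
  by rewrite in_itv /= => /andP[at_ tb]; have [] := dq t (rng _ (le_trans na at_)) (le_trans tb b0).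
have Nn0 : - n <= 0 by lra.
have [a] := EVT_min Nn0 (cts _ _ _ _ dp (lexx _) (lexx 0)).
rewrite in_itv /= => /andP[na a0] amin.
pose M := - p a.
have pM t : - n <= t -> t <= 0 -> - M <= p t.
  by move=> nt t0; rewrite opprK; apply: amin; rewrite in_itv /= nt.
have [M0|M0] := leP M 0.
  exists n => // t nt t0; apply/eqP; rewrite eq_le (pN t (rng _ nt) t0) /=.
  by apply: le_trans (pM t nt t0); lra.
exfalso.
have a0' : a < 0.
  by rewrite lt_neqAle a0 andbT; apply: contraTneq M0 => aE; rewrite /M aE p0 oppr0 ltxx.
have [| |x] := @MVT _ p p1 a 0 a0'.
- move=> t; rewrite in_itv /= => /andP[/ltW at_ /ltW t0].
  by apply: dp => //; apply: rng; exact: le_trans at_.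
- exact: cts dp _ _.
rewrite in_itv /= p0 => /andP[ax x0] xE.
have {}xE : p1 x * - a = M by rewrite /M -[RHS]sub0r xE sub0r.
have x1 : M <= p1 x * n.
  have p1x : 0 < p1 x by move: M0; rewrite -xE pmulr_lgt0 // oppr_gt0.
  by rewrite -xE ler_wpM2l ?(ltW p1x) //; lra.
pose h t := p1 t + C * p t + (C + 1) * M * t.
pose h1 t := p2 t + C * p1 t + (C + 1) * M.
have dh t : - e < t -> t <= 0 -> is_derive t 1 h (h1 t).
  move=> et t0.
  have := is_deriveD (is_deriveD (dp1 t et t0) (is_deriveZ C (dp t et t0)))
    (is_deriveZ ((C + 1) * M) (is_derive_id t (1 : R))).
  by rewrite /GRing.scale /= mulr1.
have nx : - n <= x by rewrite (le_trans na) // ltW.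
have hx : 0 < h x.
  rewrite -(pmulr_lgt0 _ n0) /h.
  have px := pM x nx (ltW x0).
  have : C * p x >= - (C * M) by rewrite -mulrN ler_wpM2l.
  have : (C + 1) * M * x >= - ((C + 1) * M).
    by rewrite -mulrN1 ler_wpM2l ?mulr_ge0 ?(ltW M0) //; lra.
  move: x1 nC M0 n0 C0; nra.
have [m] := EVT_max (ltW x0) (cts _ _ _ _ dh nx (lexx 0)).
rewrite in_itv /= => /andP[xm m0] mmax.
have hm : 0 < h m.
  by apply: lt_le_trans hx _; apply: mmax; rewrite in_itv /= lexx ltW.
have m0' : m < 0.
  rewrite lt_neqAle m0 andbT; apply: contraTneq hm => ->.
  by rewrite /h p0 p10 !mulr0 !addr0 ltxx.
have nm : - n <= m by exact: le_trans xm.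
have p1m : 0 < p1 m.
  have : C * p m <= 0 by rewrite mulr_ge0_le0 // pN // rng.
  have : (C + 1) * M * m <= 0.
    by rewrite mulr_ge0_le0 // mulr_ge0 ?(ltW M0) //; lra.
  by move: hm; rewrite /h; lra.
have h1m : 0 < h1 m.
  have := p2N m (rng _ nm) m0; rewrite gtr0_norm // ler0_norm; last exact: pN (rng _ nm) m0.
  have : C * - p m <= C * M by rewrite ler_wpM2l // lerNl; exact: pM.
  by move: M0; rewrite /h1; nra.
have [s s0 Hs] := is_derive_incr_right (dh m (rng _ nm) m0) h1m.
pose r := Num.min s (- m) / 2.
have mm : 0 < Num.min s (- m) by rewrite lt_min s0 oppr_gt0.
have r0 : 0 < r by rewrite divr_gt0.
have : r < Num.min s (- m) by rewrite ltr_pdivrMr // ltr_pMr // ltr1n.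
rewrite lt_min => /andP[rs rm].
have := Hs r r0 rs; rewrite ltNge mmax // in_itv /=.
by apply/andP; split; lra.
Qed.

End Vanishing.

(** * Locally Lipschitz functions *)

Section LocallyLipschitz.
Context {R : realType} {d : nat}.
Variable z : 'rV[R]_d.
Implicit Types (f g : 'rV[R]_d -> R) (u v : 'rV[R]_d -> 'rV[R]_d).

Definition loc_lip f : Prop := exists C e : R, [/\ 0 <= C, 0 < e &
  forall y w, `|z - y| < e -> `|z - w| < e -> `|f y - f w| <= C * `|y - w|].

Lemma loc_lip_cst (a : R) : loc_lip (fun=> a).
Proof. by exists 0, 1; split=> // y w _ _; rewrite subrr normr0 mul0r. Qed.

Lemma coord_le_norm (x : 'rV[R]_d) i : `|x 0 i| <= `|x|.
Proof.
by rewrite [leRHS]/Num.Def.normr /= mx_normrE; exact: (le_bigmax _ _ (0, i)).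
Qed.

Lemma loc_lip_coord i : loc_lip (fun y => y 0 i).
Proof.
exists 1, 1; split=> // y w _ _; rewrite mul1r.
by have := coord_le_norm (y - w) i; rewrite !mxE.
Qed.

Lemma loc_lip_bounded f : loc_lip f ->
  exists2 B : R, 0 <= B & \forall y \near z, `|f y| <= B.
Proof.
move=> [C [e [C0 e0 H]]]; exists (`|f z| + C * e).
  by rewrite addr_ge0 // mulr_ge0 // ltW.
apply/nbhs_normP; exists e => // y /= zy.
have := H y z zy; rewrite subrr normr0 => /(_ e0) yz.
have := ler_normD (f z) (f y - f z); rewrite subrKC => /le_trans; apply.
rewrite lerD2l (le_trans yz) // ler_wpM2l // distrC; exact: ltW.
Qed.

Lemma loc_lip_small f (k : R) : loc_lip f -> 0 < k ->
  \forall y \near z, `|f y - f z| < k.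
Proof.
move=> [C [e [C0 e0 H]]] k0; have C1 : 0 < C + 1 by lra.
apply/nbhs_normP; exists (Num.min e (k / (C + 1))).
  by rewrite /= lt_min e0 divr_gt0.
move=> y /=; rewrite lt_min => /andP[ye].
rewrite ltr_pdivlMr // => yk.
have := H y z ye; rewrite subrr normr0 => /(_ e0) /le_lt_trans; apply.
by apply: le_lt_trans yk; rewrite mulrC distrC ler_wpM2l //; lra.
Qed.

Lemma loc_lip_pos f : loc_lip f -> 0 < f z -> \forall y \near z, f z / 2 <= f y.
Proof.
move=> lf f0; have h0 : 0 < f z / 2 by rewrite divr_gt0.
by apply: filterS (loc_lip_small lf h0) => y /ltr_normlP[+ _]; lra.
Qed.

Lemma loc_lipD f g : loc_lip f -> loc_lip g -> loc_lip (fun y => f y + g y).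
Proof.
move=> [C [e [C0 e0 H]]] [C' [e' [C'0 e'0 H']]].
exists (C + C'), (Num.min e e'); split; first exact: addr_ge0.
  by rewrite lt_min e0.
move=> y w; rewrite !lt_min => /andP[ye ye'] /andP[we we'].
rewrite opprD addrACA (le_trans (ler_normD _ _)) // mulrDl.
by rewrite lerD ?H ?H'.
Qed.

Lemma loc_lipM f g : loc_lip f -> loc_lip g -> loc_lip (fun y => f y * g y).
Proof.
move=> lf lg; have [B B0 HB] := loc_lip_bounded lf.
have [B' B'0 HB'] := loc_lip_bounded lg.
move: lf lg => [C [e [C0 e0 H]]] [C' [e' [C'0 e'0 H']]].
have : \forall y \near z, `|f y| <= B /\ `|g y| <= B' by exact: filterI.
move=> /nbhs_normP[k /= k0 Hk].
exists (B * C' + B' * C), (Num.min k (Num.min e e')); split.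
- by rewrite addr_ge0 // mulr_ge0.
- by rewrite !lt_min k0 e0.
move=> y w; rewrite !lt_min => /and3P[yk ye ye'] /and3P[wk we we'].
have -> : f y * g y - f w * g w = f y * (g y - g w) + g w * (f y - f w) by ring.
rewrite (le_trans (ler_normD _ _)) // !normrM mulrDl -!mulrA.
have [yB _] := Hk y yk; have [_ wB'] := Hk w wk.
by apply: lerD; apply: ler_pM => //; [exact: H'|exact: H].
Qed.

Lemma loc_lipN f : loc_lip f -> loc_lip (fun y => - f y).
Proof.
move=> [C [e [C0 e0 H]]]; exists C, e; split=> // y w ye we.
by rewrite -opprD normrN H.
Qed.

Lemma loc_lip_sum (F : 'I_d -> 'rV[R]_d -> R) : (forall i, loc_lip (F i)) ->
  loc_lip (fun y => \sum_(i < d) F i y).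
Proof.
move=> lF; suff -> : (fun y => \sum_(i < d) F i y) = \sum_(i < d) F i.
  by apply: (big_ind loc_lip) => //; [exact: loc_lip_cst|exact: loc_lipD].
by apply/funext => y; rewrite fct_sumE.
Qed.

Lemma loc_lip_dotv u v : (forall i, loc_lip (fun y => u y 0 i)) ->
  (forall i, loc_lip (fun y => v y 0 i)) -> loc_lip (fun y => dotv (u y) (v y)).
Proof. by move=> lu lv; apply: loc_lip_sum => i; exact: loc_lipM. Qed.

Lemma norm_dotv_le (x y : 'rV[R]_d) (B : R) : (forall i, `|y 0 i| <= B) ->
  `|dotv x y| <= d%:R * B * `|x|.
Proof.
move=> H; rewrite (le_trans (ler_norm_sum _ _ _)) //.
rewrite (@le_trans _ _ (\sum_(i < d) (B * `|x|))) //.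
  by apply: ler_sum => i _; rewrite normrM mulrC ler_pM // coord_le_norm.
by rewrite sumr_const card_ord -mulrA mulr_natl.
Qed.

Lemma smooth_loc_lip U g : open_nbhs z U -> smooth_on U g -> loc_lip g.
Proof.
move=> zU sg; have Uz : U z by case: zU.
pose B : R := \big[Num.max/0]_(i < d) (`|partial i g z| + 1).
have nB : \forall y \near z, forall i, `|partial i g y| <= B.
  apply: (@filter_forall _ _ (fun i y => `|partial i g y| <= B) (nbhs z)) => i.
  have c : {for z, continuous (partial i g)}.
    apply: differentiable_continuous.
    by apply: smooth_on_differentiable Uz; exact: smooth_on_partial.
  have : \forall y \near z, `|partial i g y| < `|partial i g z| + 1.
    move/(@cvg_norm _ _ _ _ _): c => /cvgr_lt; apply.
    by rewrite ltrDl.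
  apply: filterS => y /ltW /le_trans; apply.
  exact: (le_bigmax _ (fun i => `|partial i g z| + 1) i).
have : \forall y \near z, U y /\ forall i, `|partial i g y| <= B.
  by apply: filterI => //; exact: open_nbhs_nbhs.
move=> /nbhs_normP[e /= e0 He].
have B0 : 0 <= B by exact: bigmax_ge_id.
exists (d%:R * B), e; split=> //; first by rewrite mulr_ge0.
move=> y w ye we.
have seg (t : R) : 0 <= t -> t <= 1 -> `|z - (w + t *: (y - w))| < e.
  move=> t0 t1.
  have -> : z - (w + t *: (y - w)) = (1 - t) *: (z - w) + t *: (z - y).
    by apply/rowP => i; rewrite !mxE; ring.
  rewrite (le_lt_trans (ler_normD _ _)) // !normrZ !ger0_norm ?subr_ge0 //.
  have [->|t0'] := eqVneq t 0; first by rewrite subr0 mul1r mul0r addr0.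
  have tp : 0 < t by rewrite lt_def t0' t0.
  rewrite (@lt_le_trans _ _ ((1 - t) * e + t * e)) //.
    by rewrite ler_ltD // ?ltr_pM2l // ler_wpM2l ?subr_ge0 // ltW.
  by rewrite -mulrDl subrK mul1r.
have dq (t : R) : 0 <= t -> t <= 1 -> is_derive t 1 (fun t : R => g (w + t *: (y - w)))
    (dotv (y - w) (grad g (w + t *: (y - w)))).
  move=> t0 t1; apply: is_derive_line; apply: smooth_on_differentiable sg _.
  by have [] := He _ (seg t t0 t1).
have di (t : R) : t \in `]0, 1[ ->
    is_derive t 1 (fun t : R => g (w + t *: (y - w)))
    (dotv (y - w) (grad g (w + t *: (y - w)))).
  by rewrite in_itv /= => /andP[/ltW t0 /ltW t1]; exact: dq.
have [|t] := MVT ltr01 di.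
  apply: derivable_within_continuous => t; rewrite in_itv /= => /andP[t0 t1].
  by have [] := dq t t0 t1.
rewrite in_itv /= => /andP[/ltW t0 /ltW t1].
rewrite scale0r addr0 scale1r subrKC subr0 mulr1 => ->.
apply: norm_dotv_le => i; rewrite mxE.
by have [_] := He _ (seg t t0 t1).
Qed.

Lemma loc_lip_grad U g i : open_nbhs z U -> smooth_on U g ->
  loc_lip (fun y => grad g y 0 i).
Proof.
move=> zU sg.
have -> : (fun y => grad g y 0 i) = partial i g by apply/funext => y; rewrite mxE.
by apply: smooth_loc_lip zU _; exact: smooth_on_partial.
Qed.

Lemma loc_lip_hess U g u v : open_nbhs z U -> smooth_on U g ->
  (forall i, loc_lip (fun y => u y 0 i)) ->
  (forall i, loc_lip (fun y => v y 0 i)) ->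
  loc_lip (fun y => hess g y (u y) (v y)).
Proof.
move=> zU sg lu lv; apply: loc_lip_dotv => // i.
have -> : (fun y => (\row_j dotv (v y) (grad (partial j g) y)) 0 i) =
    (fun y => dotv (v y) (grad (partial i g) y)).
  by apply/funext => y; rewrite mxE.
apply: loc_lip_dotv => // j; apply: loc_lip_grad zU _.
exact: smooth_on_partial.
Qed.

End LocallyLipschitz.

(** * The Hessian near the boundary *)

Section HessianLowerBound.
Context {R : realType} {d : nat}.
Variables (z X : 'rV[R]_d) (U : set 'rV[R]_d) (g : 'rV[R]_d -> R) (c t0 : R).
Hypotheses (zU : open_nbhs z U) (sg : smooth_on U g) (gz : g z = 0)
  (Nz : grad g z != 0) (z0 : z != 0).
Hypothesis Hb : forall w, U w -> g w = 0 -> boundary_form c g w.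
Hypothesis Hc : c = 0 \/ z = t0 *: X.

(** The tangential part of [X], scaled by [|grad g|^2] to be polynomial in the
    derivatives of [g]. *)
Let V y := dotv (grad g y) (grad g y) *: X - dotv X (grad g y) *: grad g y.

Let Q y := dotv y y * hess g y (V y) (V y)
  - c * dotv y (grad g y) * dotv (V y) (V y).

Let lX i : loc_lip z (fun=> X 0 i). Proof. exact: loc_lip_cst. Qed.

Let lN i : loc_lip z (fun y => grad g y 0 i). Proof. exact: loc_lip_grad sg. Qed.

Let lid i : loc_lip z (fun y => y 0 i). Proof. exact: loc_lip_coord. Qed.

Let lV i : loc_lip z (fun y => V y 0 i).
Proof.
have -> : (fun y => V y 0 i) = (fun y => dotv (grad g y) (grad g y) * X 0 i
    + - (dotv X (grad g y) * grad g y 0 i)).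
  by apply/funext => y; rewrite !mxE.
apply: loc_lipD; first by apply: loc_lipM; [exact: loc_lip_dotv|exact: lX].
by apply: loc_lipN; apply: loc_lipM; [exact: loc_lip_dotv|exact: lN].
Qed.

Let lQ : loc_lip z Q.
Proof.
apply: loc_lipD.
  by apply: loc_lipM; [exact: loc_lip_dotv|exact: loc_lip_hess sg _ _].
apply: loc_lipN; apply: loc_lipM; last exact: loc_lip_dotv.
by apply: loc_lipM; [exact: loc_lip_cst|exact: loc_lip_dotv].
Qed.

Let V_tangent y : dotv (V y) (grad g y) = 0.
Proof. by rewrite /V dotvDl dotvNl !dotvZl; ring. Qed.

Let Q_ge0 : \forall w \near z, g w = 0 -> 0 <= Q w.
Proof.
have zz : 0 < dotv z z by rewrite dotv_gt0.
have := loc_lip_pos (loc_lip_dotv lid lid) zz.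
apply: filterS2 (open_nbhs_nbhs zU) => w Uw ww gw.
have {}ww : 0 < dotv w w by apply: lt_le_trans ww; rewrite divr_gt0.
rewrite /Q subr_ge0; apply: le_trans (ler_wpM2l (ltW ww) (Hb Uw gw (V_tangent w))).
move: (dotv (V w) _) (dotv w (grad g w)) => v a.
by rewrite le_eqVlt; apply/orP; left; apply/eqP; field; rewrite gt_eqF.
Qed.

(** Going from [y] in the direction of [grad g z] one reaches [g = 0] within a
    distance [O (|g y|)], because the slope of [g] there is at least
    [|grad g z|^2 / 2]. *)
Lemma dist_zero_set : exists2 K : R, 0 <= K & forall e : R, 0 < e ->
  \forall y \near z, g y <= 0 ->
  exists w, [/\ `|z - w| < e, g w = 0 & `|y - w| <= K * `|g y|].
Proof.
pose n := grad g z; pose m := dotv n n / 2.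
have nn : 0 < dotv n n by rewrite dotv_gt0.
have m0 : 0 < m by rewrite divr_gt0.
exists (`|n| / m); first by rewrite divr_ge0 // ltW.
move=> e e0.
have : \forall y \near z, U y /\ m <= dotv n (grad g y).
  apply: filterI; first exact: open_nbhs_nbhs.
  by apply: (loc_lip_pos (f := fun y => dotv n (grad g y))) => //;
    apply: loc_lip_dotv => // i; exact: loc_lip_cst.
move=> /nbhs_normP[r /= r0 Hr].
pose k := Num.min r e; have k0 : 0 < k by rewrite lt_min r0.
have p0 : 0 < k * m / (2 * (`|n| + 1)).
  by rewrite divr_gt0 // mulr_gt0 // ltr_wpDl.
have := loc_lip_small (smooth_loc_lip zU sg) p0.
have : \forall y \near z, `|z - y| < k / 2.
  by apply/nbhs_normP; exists (k / 2) => //=; rewrite divr_gt0.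
apply: filterS2 => y zy; rewrite gz subr0 => yk gy.
pose s1 := `|g y| / m.
have s10 : 0 <= s1 by rewrite divr_ge0 // ltW.
have s1k : s1 * (`|n| + 1) < k / 2.
  move: yk; rewrite ltr_pdivlMr ?mulr_gt0 ?ltr_wpDl // => yk.
  rewrite /s1 mulrAC ltr_pdivrMr //; lra.
have seg (s : R) : 0 <= s -> s <= s1 -> `|z - (y + s *: n)| < k.
  move=> s0 ss; rewrite opprD addrA (le_lt_trans (ler_normB _ _)) //.
  rewrite normrZ ger0_norm //.
  have : s * `|n| <= s1 * (`|n| + 1) by apply: ler_pM => //; rewrite lerDl.
  lra.
have dh (s : R) : 0 <= s -> s <= s1 ->
    is_derive s 1 (fun s : R => g (y + s *: n)) (dotv n (grad g (y + s *: n))).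
  move=> s0 ss; apply: is_derive_line; apply: smooth_on_differentiable sg _.
  by have := seg s s0 ss; rewrite lt_min => /andP[/Hr[]].
have ch : {within `[0, s1], continuous (fun s : R => g (y + s *: n))}.
  apply: derivable_within_continuous => s; rewrite in_itv /= => /andP[s0 ss].
  by have [] := dh s s0 ss.
have di (s : R) : s \in `]0, s1[ ->
    is_derive s 1 (fun s : R => g (y + s *: n)) (dotv n (grad g (y + s *: n))).
  by rewrite in_itv /= => /andP[/ltW s0 /ltW ss]; exact: dh.
have [s] := MVT_segment s10 di ch.
rewrite in_itv /= => /andP[s0 ss]; rewrite scale0r addr0 subr0 => E.
have gs1 : 0 <= g (y + s1 *: n).
  have [_ mn] : U (y + s *: n) /\ m <= dotv n (grad g (y + s *: n)).
    by apply: Hr => /=; have := seg s s0 ss; rewrite lt_min => /andP[].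
  have : m * s1 <= dotv n (grad g (y + s *: n)) * s1 by rewrite ler_wpM2r.
  rewrite -E /s1 mulrCA divff ?gt_eqF // mulr1 ler0_norm //; lra.
have [|s'] := IVT (v := 0) s10 ch.
  by rewrite scale0r addr0 ge_min le_max gy gs1 orbT.
rewrite in_itv /= => /andP[s'0 s's] gw.
exists (y + s' *: n); split=> //.
  by have := seg s' s'0 s's; rewrite lt_min => /andP[].
rewrite opprD addrA subrr sub0r normrN normrZ ger0_norm //.
rewrite (@le_trans _ _ (s1 * `|n|)) // ?ler_wpM2r //.
by rewrite /s1 mulrAC [leRHS]mulrAC (mulrC `|n|).
Qed.

(** With [N = grad g y], the bound for the tangent vector [V] becomes one for
    [X] up to terms with a factor [X . N], and in the radial case [y . N] is
    itself a multiple of [X . N]. *)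
Lemma hess_lower_bound : exists2 C : R, 0 <= C & \forall y \near z,
  (exists2 t : R, `|t| <= 1 & y = z + t *: X) -> g y <= 0 ->
  - C * (`|dotv X (grad g y)| + `|g y|) <= hess g y X X.
Proof.
have [K K0 HK] := dist_zero_set.
have [L [e [L0 e0 HL]]] := lQ.
have : \forall w \near z, U w /\ (g w = 0 -> 0 <= Q w).
  by apply: filterI; [exact: open_nbhs_nbhs|exact: Q_ge0].
move=> /nbhs_normP[r /= r0 Hr].
have k0 : 0 < Num.min e r by rewrite lt_min e0.
have Q_near : \forall y \near z, g y <= 0 -> - (L * K) * `|g y| <= Q y.
  have : \forall y \near z, `|z - y| < e by apply/nbhs_normP; exists e.
  apply: filterS2 (HK _ k0) => y Hy ye /Hy[w [+ gw yw]].
  rewrite lt_min => /andP[we wr].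
  have [_ /(_ gw) Qw] := Hr w wr.
  have /ler_normlP[+ _] := HL y w ye we.
  have : L * `|y - w| <= L * (K * `|g y|) by rewrite ler_wpM2l.
  by move: (Q y) (Q w) Qw => qy qw Qw; rewrite mulrA mulNr; lra.
have [B1 B10 HB1] := loc_lip_bounded (loc_lip_dotv lV lV).
have [B2 B20 HB2] := loc_lip_bounded
  (loc_lipM (loc_lip_dotv lid lid) (loc_lipM (loc_lip_dotv lN lN)
    (loc_lipD (loc_lip_hess zU sg lX lN) (loc_lip_hess zU sg lN lX)))).
have [B3 B30 HB3] := loc_lip_bounded
  (loc_lipM (loc_lip_dotv lid lid) (loc_lipM (loc_lip_dotv lX lN)
    (loc_lip_hess zU sg lN lN))).
have NN : 0 < dotv (grad g z) (grad g z) by rewrite dotv_gt0.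
have zz : 0 < dotv z z by rewrite dotv_gt0.
pose F y := dotv y y * (dotv (grad g y) (grad g y) * dotv (grad g y) (grad g y)).
have lF : loc_lip z F by apply: loc_lipM; [|apply: loc_lipM]; exact: loc_lip_dotv.
have F0 : 0 < F z by rewrite !mulr_gt0.
pose k := F z / 2; have kp : 0 < k by rewrite divr_gt0.
pose A1 := `|c| * (`|t0| + 1) * B1 + B2 + B3.
have A10 : 0 <= A1 by rewrite !addr_ge0 // !mulr_ge0 // addr_ge0.
pose A := L * K + A1.
have A0 : 0 <= A by rewrite addr_ge0 // mulr_ge0.
exists (A / k); first by rewrite divr_ge0 // ltW.
near=> y => -[t t1 yE] gy.
have Fk : k <= F y by near: y; exact: loc_lip_pos.
have Qy : - (L * K) * `|g y| <= Q y by move: gy; near: y.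
have b1 : `|dotv (V y) (V y)| <= B1 by near: y.
have b2 : `|dotv y y * (dotv (grad g y) (grad g y) *
   (hess g y X (grad g y) + hess g y (grad g y) X))| <= B2 by near: y.
have b3 : `|dotv y y * (dotv X (grad g y) * hess g y (grad g y) (grad g y))| <= B3
  by near: y.
set b := dotv X (grad g y).
have [c' c'0 cE] : exists2 c', `|c'| <= `|c| * (`|t0| + 1) &
    c * dotv y (grad g y) = c' * b.
  case: Hc => [->|zE].
    by exists 0; rewrite ?mul0r // normr0 mul0r.
  exists (c * (t0 + t)).
    by rewrite normrM ler_wpM2l // (le_trans (ler_normD _ _)) // lerD2l.
  have yX : y = (t0 + t) *: X by rewrite yE zE scalerDl.
  by rewrite {1}yX dotvZl mulrA.
have E : F y * hess g y X X = Q y + c' * b * dotv (V y) (V y)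
  + b * (dotv y y * (dotv (grad g y) (grad g y) *
     (hess g y X (grad g y) + hess g y (grad g y) X)))
  - b * (dotv y y * (b * hess g y (grad g y) (grad g y))).
  have VE : V y = dotv (grad g y) (grad g y) *: X + (- b) *: grad g y.
    by rewrite scaleNr.
  rewrite /Q cE /F; move: (dotv (V y) (V y)) => v.
  by rewrite VE !(hessDl, hessDr, hessZl, hessZr); ring.
have Ib u B : `|u| <= B -> - (B * `|b|) <= b * u.
  move=> uB; rewrite lerNl -mulNr; apply: le_trans (ler_norm _) _.
  by rewrite normrM normrN mulrC ler_wpM2r.
have i1 : - (`|c| * (`|t0| + 1) * B1 * `|b|) <= c' * b * dotv (V y) (V y).
  rewrite [c' * b]mulrC -[leRHS]mulrA; apply: Ib; rewrite normrM.
  by apply: ler_pM.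
have i2 := Ib _ _ b2.
have i3 : - (B3 * `|b|) <= - (b * (dotv y y * (b * hess g y (grad g y) (grad g y)))).
  by rewrite -[leRHS]mulrN; apply: Ib; rewrite normrN.
have FH : - A * (`|b| + `|g y|) <= F y * hess g y X X.
  have h1 : 0 <= L * K * `|b| by rewrite !mulr_ge0.
  have h2 : 0 <= A1 * `|g y| by rewrite mulr_ge0.
  rewrite E; move: i1 i2 i3 Qy h1 h2; rewrite /A /A1 !mulrDl !mulNr.
  move: (Q y) (c' * b * _) (b * (dotv y y * (_ * _))) (b * (dotv y y * _)).
  move=> q p1 p2 p3; lra.
have Fp : 0 < F y by exact: lt_le_trans kp Fk.
have S0 : 0 <= `|b| + `|g y| by rewrite addr_ge0.
rewrite -(ler_pM2l Fp); apply: le_trans FH.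
rewrite mulrA ler_wpM2r // mulrN lerN2.
by rewrite mulrCA ler_peMr // ler_pdivlMr // mul1r.
Unshelve. all: by end_near. Qed.

End HessianLowerBound.

(** * Domains containing the origin are convex *)

Section InteriorOrigin.
Context {R : realType} {d : nat}.
Implicit Types (p w x y z X : 'rV[R]_d) (g : 'rV[R]_d -> R)
  (U Omega : set 'rV[R]_d).

Lemma zero_set_frontier Omega U g w : open Omega -> open_nbhs w U ->
  smooth_on U g -> grad g w != 0 ->
  (forall y, U y -> (Omega y <-> g y < 0)) -> g w = 0 -> frontier Omega w.
Proof.
move=> oO wU sg Ng Og gw; have Uw : U w by case: wU.
apply/(open_frontier _ oO); split; last by move/(Og w Uw); rewrite gw ltxx.
move=> A Aw.
have [q [e e0 [dq q0 _]]] := parabola_second_order (- grad g w) 0 wU sg.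
have := dq 0 (lexx 0) e0; rewrite q0 dotvNl => {}dq.
have [| |e1 e10 H1] := is_derive_neg_right _ dq.
- by rewrite on_parabola0.
- by rewrite oppr_lt0 dotv_gt0.
have [e2 e20 H2] := parabola_nbhs (- grad g w) 0 (filterI Aw (open_nbhs_nbhs wU)).
pose m := Num.min e1 e2.
have m0 : 0 < m by rewrite lt_min e10.
have t0 : 0 < m / 2 by rewrite divr_gt0.
have : m / 2 < m by rewrite ltr_pdivrMr // ltr_pMr // ltr1n.
rewrite {2}/m lt_min => /andP[te1 te2].
have [Ay Uy] := H2 (m / 2) ltac:(by rewrite gtr0_norm).
by eexists; split; [apply/(Og _ Uy); exact: H1 te1|exact: Ay].
Qed.

(** A segment lying in the closure of [Omega] and touching the boundary at [z]
    is outside [Omega] just before [z]: along it a defining function is [<= 0]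
    with value and derivative [0] at [z], and its second derivative is bounded
    below by the curvature of the boundary. *)
Lemma touching_segment Omega z X (c t0 e : R) : open Omega ->
  smooth_boundary Omega -> frontier Omega z -> z != 0 ->
  (forall w g, frontier Omega w -> defining_function Omega w g ->
     boundary_form c g w) ->
  c = 0 \/ z = t0 *: X -> 0 < e ->
  (forall s : R, `|s| < e -> closure Omega (z + s *: X)) ->
  exists2 n : R, 0 < n & forall s, - n <= s -> s <= 0 -> ~ Omega (z + s *: X).
Proof.
move=> oO sO fz z0 Hb Hc e0 clO.
have [g dg] := sO z fz; have gz := defining_vanish oO fz dg.
have [U [zU sg Ng Og]] := dg; have Uz : U z by case: zU.
have Hb' w : U w -> g w = 0 -> boundary_form c g w.
  move=> Uw gw; have wU : open_nbhs w U by case: zU.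
  apply: Hb; last by exists U.
  exact: zero_set_frontier wU sg (Ng w Uw) Og gw.
have [C C0 HC] := hess_lower_bound zU sg gz (Ng z Uz) z0 Hb' Hc.
have [r r0 Hr] := line_nbhs X (filterI (open_nbhs_nbhs zU) HC).
pose k := Num.min e (Num.min r 1).
have k0 : 0 < k by rewrite !lt_min e0 r0 /=.
have kP (s : R) : `|s| < k ->
    [/\ U (z + s *: X), g (z + s *: X) <= 0 &
      - C * (`|dotv X (grad g (z + s *: X))| + `|g (z + s *: X)|)
        <= hess g (z + s *: X) X X].
  rewrite !lt_min => /and3P[se sr s1]; have [Us Hs] := Hr s sr.
  have gs : g (z + s *: X) <= 0.
    apply: (closure_sublevel_le0 (U := U)) (clO s se) => //; first by case: zU.
    apply: differentiable_continuous.
    exact: smooth_on_differentiable sg Us.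
  by split=> //; apply: Hs => //; exists s => //; exact: ltW.
have dphi (s : R) : `|s| < k -> is_derive s 1 (fun s : R => g (z + s *: X))
    (dotv X (grad g (z + s *: X))).
  move=> /kP[Us _ _]; apply: is_derive_line.
  exact: smooth_on_differentiable sg Us.
have dphi1 (s : R) : `|s| < k ->
    is_derive s 1 (fun s : R => dotv X (grad g (z + s *: X)))
      (hess g (z + s *: X) X X).
  move=> /kP[Us _ _].
  have dpar i : is_derive s 1 (fun s : R => partial i g (z + s *: X))
      (dotv X (grad (partial i g) (z + s *: X))).
    apply: is_derive_line; apply: smooth_on_differentiable Us.
    exact: smooth_on_partial.
  have := is_derive_sum (fun i => is_deriveZ (X 0 i) (dpar i)).
  have -> : \sum_(i < d) (X 0 i \*: (fun s : R => partial i g (z + s *: X))) =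
      (fun s : R => dotv X (grad g (z + s *: X))).
    apply/funext => t; rewrite fct_sumE /dotv; apply: eq_bigr => i _.
    by rewrite mxE.
  have -> // : \sum_(i < d) X 0 i *: dotv X (grad (partial i g) (z + s *: X))
    = hess g (z + s *: X) X X.
  by apply: eq_bigr => i _; rewrite mxE.
have rng (s : R) : - k < s -> s <= 0 -> `|s| < k.
  by move=> ks s0; rewrite ler0_norm // ltrNl.
have crit : dotv X (grad g (z + 0 *: X)) = 0.
  have kk : - k <= k by lra.
  have k00 : (0 : R) \in `]- k, k[ by rewrite in_itv /= k0 oppr_lt0 k0.
  have dk (t : R) : t \in `]- k, k[ -> derivable (fun s : R => g (z + s *: X)) t 1.
    by rewrite in_itv /= -ltr_norml => /dphi dt; have [] := dt.
  have [|_ D0] := derive1_at_max kk dk k00.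
    by move=> t; rewrite in_itv /= -ltr_norml scale0r addr0 gz; case/kP.
  have [_ <-] := dphi 0 ltac:(by rewrite normr0).
  by rewrite D0.
have [| | | | | |n n0 Hn] := second_order_vanish k0 C0
  (p := fun s : R => g (z + s *: X))
  (p1 := fun s : R => dotv X (grad g (z + s *: X)))
  (p2 := fun s : R => hess g (z + s *: X) X X).
- by move=> s ks s0; apply: dphi; exact: rng.
- by move=> s ks s0; apply: dphi1; exact: rng.
- by move=> s ks s0; case: (kP s (rng s ks s0)).
- by move=> s ks s0; case: (kP s (rng s ks s0)).
- by rewrite scale0r addr0.
- exact: crit.
exists (Num.min n (k / 2)); first by rewrite lt_min n0 divr_gt0.
move=> s; rewrite lerNl le_min => /andP[sn sk] s0.
have ks : - k < s by lra.
have [Us _ _] := kP s (rng s ks s0).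
by move/(Og _ Us); rewrite Hn ?ltxx // lerNl.
Qed.

(** With [c = 1 - alpha] and [p = 0] this is geodesic convexity towards the
    vertex of the cone; with [c = 0] it is the classical statement that a
    connected domain with nonnegative second fundamental form is convex. *)
Lemma star_shaped Omega p (c : R) : open Omega -> connected Omega ->
  smooth_boundary Omega -> Omega 0 -> Omega p ->
  (forall w g, frontier Omega w -> defining_function Omega w g ->
     boundary_form c g w) ->
  c = 0 \/ p = 0 ->
  forall y, Omega y -> forall t : R, 0 <= t <= 1 -> Omega (p + t *: (y - p)).
Proof.
move=> oO cO sO O0 Op Hb cp; apply: star_shaped_connected => // y Oy clO t t01.
apply: contrapT => nO; pose X := y - p.
have [|t0 [t00 nt0 Hlt]] := @first_exit _ _ Omega p X oO Op.
  by exists t => //; case/andP: t01.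
have t0t : t0 <= t.
  by rewrite leNgt; apply/negP => tt0; apply: nO; apply: Hlt => //; case/andP: t01.
have t01' : t0 < 1.
  case/andP: t01 => _ t1; rewrite lt_neqAle (le_trans t0t t1) andbT.
  by apply: contra_notN nt0 => /eqP ->; rewrite scale1r /X subrKC.
pose e := Num.min t0 (1 - t0).
have e0 : 0 < e by rewrite lt_min t00 subr_gt0.
have z0 : p + t0 *: X != 0 by apply: contra_notN nt0 => /eqP ->.
have fz : frontier Omega (p + t0 *: X).
  by apply/(open_frontier _ oO); split=> //; apply: clO; rewrite !ltW.
have cz : c = 0 \/ p + t0 *: X = t0 *: X.
  by case: cp => [|->]; [left|right; rewrite add0r].
have [s se|n n0 Hn] := touching_segment oO sO fz z0 Hb cz e0.
  rewrite -addrA -scalerDl; apply: clO.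
  by move: se; rewrite lt_min !ltr_norml => /andP[/andP[? ?] /andP[? ?]]; lra.
pose s := Num.min n t0.
have s0 : 0 < s by rewrite lt_min n0.
have sn : s <= n by rewrite ge_min lexx.
have st : s <= t0 by rewrite ge_min lexx orbT.
apply: (Hn (- s)); [lra|lra|].
by rewrite -addrA -scalerDl; apply: Hlt; lra.
Qed.

(** If [w . grad g < 0], moving outwards along the ray through [w] enters
    [Omega], and then star-shapedness puts [w] itself in [Omega]. *)
Lemma star_shaped_normal Omega w g : open Omega -> frontier Omega w ->
  defining_function Omega w g ->
  (forall y, Omega y -> forall t : R, 0 <= t <= 1 -> Omega (t *: y)) ->
  0 <= dotv w (grad g w).
Proof.
move=> oO fw dg star; have gw := defining_vanish oO fw dg.
have [U [wU sg _ Og]] := dg.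
rewrite leNgt; apply/negP => Ng.
have [q [e e0 [dq q0 _]]] := parabola_second_order w 0 wU sg.
have := dq 0 (lexx 0) e0; rewrite q0 => {}dq.
have [|e1 e10 H1] := is_derive_neg_right _ dq Ng; first by rewrite on_parabola0.
have [e2 e20 H2] := parabola_nbhs w 0 (open_nbhs_nbhs wU).
pose m := Num.min e1 e2.
have m0 : 0 < m by rewrite lt_min e10.
have t0 : 0 < m / 2 by rewrite divr_gt0.
have : m / 2 < m by rewrite ltr_pdivrMr // ltr_pMr // ltr1n.
rewrite {2}/m lt_min => /andP[te1 te2].
have Uy := H2 (m / 2) ltac:(by rewrite gtr0_norm).
have /(Og _ Uy)/star := H1 _ t0 te1.
move=> /(_ (1 + m / 2)^-1); rewrite scaler0 addr0 -{1}[w]scale1r -scalerDl.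
rewrite scalerA mulVf ?scale1r; last by rewrite gt_eqF // addr_gt0.
have [_ nO] := (open_frontier w oO).1 fw.
move=> Ow; apply: nO; apply: Ow.
by rewrite invr_ge0 invf_le1 ?addr_gt0 // lerDl !ltW // addr_gt0.
Qed.

Lemma convex_setP Omega : convex_set Omega <->
  forall x y, Omega x -> Omega y ->
    forall t : R, 0 <= t <= 1 -> Omega (y + t *: (x - y)).
Proof.
have E (x y : convex_lmodType 'rV[R]_d) (l : {i01 R}) :
    conv l x y = y + l%:num *: (x - y).
  rewrite (_ : conv l x y = l%:num *: x + (1 - l%:num) *: y) //.
  by rewrite scalerBr scalerBl scale1r addrCA.
split=> [H x y Ox Oy t /andP[t0 t1]|H x y l].
  have := H x y (Itv01 t0 t1); rewrite !inE E; exact.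
by rewrite !inE E => Ox Oy; apply: H => //; rewrite ge0 le1.
Qed.

Lemma interior_origin_convex (alpha : R) Omega : alpha < 1 ->
  bounded_domain Omega -> II_lower_bound alpha Omega -> Omega 0 ->
  convex_set Omega.
Proof.
move=> a1 [_ oO cO _ sO] /(II_lower_boundP _ oO sO) H O0.
have Hb w g : frontier Omega w -> defining_function Omega w g ->
    boundary_form (1 - alpha) g w.
  move=> fw dg; have [h dh Hh] := H w fw.
  exact: (boundary_form_indep oO fw dh dg Hh).
have star0 y : Omega y -> forall t : R, 0 <= t <= 1 -> Omega (t *: y).
  move=> Oy t t01.
  have := star_shaped oO cO sO O0 O0 Hb (or_intror erefl) Oy t01.
  by rewrite subr0 add0r.
have H0 w g : frontier Omega w -> defining_function Omega w g ->
    boundary_form 0 g w.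
  move=> fw dg X Xg; apply: le_trans (Hb w g fw dg X Xg).
  have wN := star_shaped_normal oO fw dg star0.
  by rewrite !mul0r !mulr_ge0 ?subr_ge0 ?invr_ge0 ?dotv_ge0 // ltW.
apply/convex_setP => x y Ox Oy.
exact: (star_shaped oO cO sO O0 Oy H0 (or_introl erefl) Ox).
Qed.

End InteriorOrigin.

(** * A family of quartic domains *)

Section PolynomialFunctions.
Context {R : realType} {d : nat}.
Implicit Types (f g : 'rV[R]_d -> R) (U : set 'rV[R]_d).

(** Closed under partial derivatives, so that smoothness follows from mere
    differentiability. *)
Inductive polynomial_fun : ('rV[R]_d -> R) -> Prop :=
| polynomial_cst a : polynomial_fun (fun=> a)
| polynomial_coord i : polynomial_fun (fun y => y 0 i)
| polynomialD f g : polynomial_fun f -> polynomial_fun g ->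
    polynomial_fun (fun y => f y + g y)
| polynomialM f g : polynomial_fun f -> polynomial_fun g ->
    polynomial_fun (fun y => f y * g y).

Lemma is_derive_coord (y v : 'rV[R]_d) i :
  is_derive y v (fun x : 'rV[R]_d => x 0 i) (v 0 i).
Proof.
have dc : differentiable (fun x : 'rV[R]_d => x 0 i) y by exact: differentiable_coord.
apply: DeriveDef; first exact: diff_derivable.
have := derive_mx (@derivable_id _ _ y v); rewrite derive_id => /matrixP/(_ 0 i).
by rewrite mxE => ->.
Qed.

Lemma polynomial_differentiable f y : polynomial_fun f -> differentiable f y.
Proof.
elim=> [a|i|g h _ dg _ dh|g h _ dg _ dh].
- exact: differentiable_cst.
- exact: differentiable_coord.
- exact: differentiableD.
- exact: differentiableM.
Qed.

Lemma polynomial_partial f i : polynomial_fun f -> polynomial_fun (partial i f).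
Proof.
elim=> [a|j|g h pg IHg ph IHh|g h pg IHg ph IHh].
- rewrite (_ : partial i _ = fun=> 0); first exact: polynomial_cst.
  by apply/funext => y; rewrite /partial derive_cst.
- rewrite (_ : partial i _ = fun=> (delta_mx 0 i : 'rV[R]_d) 0 j).
    exact: polynomial_cst.
  by apply/funext => y; have [_] := is_derive_coord y (delta_mx 0 i) j.
- rewrite (_ : partial i _ = fun y => partial i g y + partial i h y).
    exact: polynomialD.
  apply/funext => y; rewrite /partial deriveD //;
    exact/diff_derivable/polynomial_differentiable.
- rewrite (_ : partial i _ = fun y => g y * partial i h y + h y * partial i g y).
    by apply: polynomialD; exact: polynomialM.
  apply/funext => y; rewrite /partial deriveM //;
    exact/diff_derivable/polynomial_differentiable.
Qed.

Lemma polynomial_smooth f U : polynomial_fun f -> smooth_on U f.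
Proof.
move=> pf s y _; apply: polynomial_differentiable.
by elim: s => // i s IH; exact: polynomial_partial.
Qed.

Lemma polynomial_sum (F : 'I_d -> 'rV[R]_d -> R) :
  (forall i, polynomial_fun (F i)) -> polynomial_fun (fun y => \sum_(i < d) F i y).
Proof.
move=> pF; rewrite (_ : (fun y => _) = \sum_(i < d) F i).
  by apply: (big_ind polynomial_fun) => //; [exact: polynomial_cst|exact: polynomialD].
by apply/funext => y; rewrite fct_sumE.
Qed.

End PolynomialFunctions.

Section QuarticDomain.
Context {R : realType} {d : nat}.
Variables (o : 'I_d) (b : R).
Hypotheses (b0 : 0 <= b) (b1 : b <= 1 / 10).
Implicit Types (x y v X : 'rV[R]_d).

Let e : 'rV[R]_d := delta_mx 0 o.

Definition offset x : 'rV[R]_d := x - 8 *: e.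
Definition sqdist x : R := dotv (offset x) (offset x).
Definition quartic x : R := sqdist x ^+ 2 - b / 2 * sqdist x - offset x 0 o.
Definition quartic_domain : set 'rV[R]_d := [set x | quartic x < 0].

Lemma dotv_delta (u : 'rV[R]_d) i : dotv u (delta_mx 0 i) = u 0 i.
Proof.
rewrite /dotv (bigD1 i) //= big1 ?addr0 => [|j ji]; rewrite !mxE eqxx /=.
  by rewrite eqxx mulr1.
by rewrite (negbTE ji) mulr0.
Qed.

Lemma sqr_coord_le (u : 'rV[R]_d) i : u 0 i ^+ 2 <= dotv u u.
Proof.
rewrite /dotv (bigD1 i) //= expr2 lerDl.
by apply: sumr_ge0 => j _; rewrite -expr2 sqr_ge0.
Qed.

Lemma offset_poly i : polynomial_fun (fun x => offset x 0 i).
Proof.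
rewrite (_ : (fun x => _) = (fun x : 'rV[R]_d => x 0 i + (- (8 *: e)) 0 i)).
  by apply: polynomialD; [exact: polynomial_coord|exact: polynomial_cst].
by apply/funext => x; rewrite !mxE.
Qed.

Lemma sqdist_poly : polynomial_fun sqdist.
Proof. by apply: polynomial_sum => i; apply: polynomialM; exact: offset_poly. Qed.

Lemma quartic_poly : polynomial_fun quartic.
Proof.
rewrite (_ : quartic = fun x => (sqdist x * sqdist x + - (b / 2) * sqdist x)
    + (-1) * offset x 0 o).
  apply: polynomialD; last by apply: polynomialM;
    [exact: polynomial_cst|exact: offset_poly].
  apply: polynomialD; apply: polynomialM; try exact: sqdist_poly.
  exact: polynomial_cst.
by apply/funext => x; rewrite /quartic; ring.
Qed.

Lemma is_derive_offset x v i :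
  is_derive x v (fun y => offset y 0 i) (v 0 i).
Proof.
rewrite (_ : (fun y => _) = (fun y : 'rV[R]_d => y 0 i) + cst ((- (8 *: e)) 0 i)).
  have := is_deriveD (is_derive_coord x v i) (is_derive_cst ((- (8 *: e)) 0 i) x v).
  by rewrite addr0.
by apply/funext => y; rewrite /offset mxE.
Qed.

Lemma is_derive_sqdist x v : is_derive x v sqdist (2 * dotv (offset x) v).
Proof.
have := is_derive_sum (fun i => is_deriveM (is_derive_offset x v i)
  (is_derive_offset x v i)).
rewrite (_ : \sum_(i < d) _ = sqdist); last first.
  by apply/funext => y; rewrite fct_sumE.
rewrite (_ : \sum_(i < d) _ = 2 * dotv (offset x) v) //.
by rewrite mulr_sumr; apply: eq_bigr => i _; rewrite /GRing.scale /=; ring.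
Qed.

Lemma grad_quartic x : grad quartic x = (4 * sqdist x - b) *: offset x - e.
Proof.
apply/rowP => i; rewrite mxE /partial.
have dq := is_derive_sqdist x (delta_mx 0 i).
have := is_deriveB (is_deriveB (is_deriveM dq dq) (is_deriveZ (b / 2) dq))
  (is_derive_offset x (delta_mx 0 i) o).
rewrite (_ : _ - _ - _ = quartic); last first.
  by apply/funext => y; rewrite /quartic expr2.
move=> [_ ->]; rewrite dotv_delta !mxE eqxx /= eq_sym /GRing.scale /=.
by field.
Qed.

Lemma hess_quartic x X : hess quartic x X X =
  8 * dotv (offset x) X ^+ 2 + (4 * sqdist x - b) * dotv X X.
Proof.
rewrite /hess.
have -> : (\row_i dotv X (grad (partial i quartic) x)) =
    (8 * dotv (offset x) X) *: offset x + (4 * sqdist x - b) *: X.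
  apply/rowP => i; rewrite mxE -derive_grad; last first.
    by apply: polynomial_differentiable; apply: polynomial_partial; exact: quartic_poly.
  have d4 : is_derive x X (fun y => 4 * sqdist y - b)
      (4 * (2 * dotv (offset x) X) - 0).
    exact: (is_deriveB (is_deriveZ 4 (is_derive_sqdist x X)) (is_derive_cst b x X)).
  have -> : partial i quartic = (fun y => 4 * sqdist y - b) *
      (fun y => offset y 0 i) - cst (e 0 i).
    apply/funext => y; transitivity (grad quartic y 0 i); first by rewrite mxE.
    have H (u v : 'rV[R]_d) c : (c *: u - v) 0 i = c * u 0 i - v 0 i.
      by rewrite 3!mxE.
    by rewrite grad_quartic H.
  have H (u v : 'rV[R]_d) a c : (a *: u + c *: v) 0 i = a * u 0 i + c * v 0 i.
    by rewrite 3!mxE.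
  have := is_deriveB (is_deriveM d4 (is_derive_offset x X i))
    (is_derive_cst (e 0 i) x X).
  by move=> [_ ->]; rewrite H /GRing.scale /=; ring.
by rewrite dotvDr !dotvZr (dotvC X); ring.
Qed.

(** With [w = offset x] and [q = |w|^2]: if [q > 11 / 10], then
    [q (q - b / 2) > q > 1], whereas [q (q - b / 2) <= w_o <= sqrt q]. *)
Lemma sqdist_bound x : quartic x <= 0 -> sqdist x <= 11 / 10.
Proof.
have := sqr_coord_le (offset x) o; rewrite -/(sqdist x) /quartic.
move: (sqdist x) (offset x 0 o) => q w hw h; rewrite leNgt; apply/negP => hq.
have : q * (q - b / 2) <= w by lra.
have q1 : 1 < q - b / 2 by move: b1 hq; lra.
have : q < q * (q - b / 2) by rewrite ltr_pMr; lra.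
nra.
Qed.

Lemma quartic_closure x : closure quartic_domain x -> quartic x <= 0.
Proof.
apply: (closure_sublevel_le0 (U := setT)) => //; first by split; [exact: openT|].
exact/differentiable_continuous/polynomial_differentiable/quartic_poly.
Qed.

Lemma quartic_domain_open : open quartic_domain.
Proof.
have cq : continuous quartic.
  by move=> x; exact/differentiable_continuous/polynomial_differentiable/quartic_poly.
rewrite (_ : quartic_domain = quartic @^-1` [set r | r < 0]) //.
by apply: open_comp => [x _|]; [exact: cq|exact: open_lt].
Qed.

Lemma quartic_frontier x : frontier quartic_domain x -> quartic x = 0.
Proof.
move/(open_frontier _ quartic_domain_open) => [/quartic_closure qx nx].
by apply/eqP; rewrite eq_le qx leNgt; apply/negP.
Qed.

(** At a critical point [(4 q - b) w = e], so that [(4 q - b)^2 q = 1]; on the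
    zero set also [q (3 q - b / 2) = 0], hence [q = 0] or [q = b / 6], and both
    are too small. *)
Lemma grad_quartic_neq0 x : quartic x = 0 -> grad quartic x != 0.
Proof.
rewrite grad_quartic => qx; apply/negP => /eqP/(subr0_eq) E.
have E1 : (4 * sqdist x - b) * sqdist x = offset x 0 o.
  by rewrite /sqdist -dotvZr E dotv_delta.
have E2 : (4 * sqdist x - b) * offset x 0 o = 1.
  by rewrite -dotv_delta -dotvZl E dotv_delta mxE !eqxx.
have := dotv_ge0 (offset x); rewrite -/(sqdist x).
move: qx E1 E2; rewrite /quartic.
move: (sqdist x) (offset x 0 o) => q w qx E1 E2 q0.
have : q * (3 * q - b / 2) = 0 by rewrite -E1 in qx; lra.
move/eqP; rewrite mulf_eq0 => /orP[/eqP qE|/eqP qE].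
  by move: E1 E2; rewrite qE mulr0 => <-; rewrite mulr0 => /eqP; rewrite eq_sym oner_eq0.
have {}qE : q = b / 6 by lra.
have : (4 * q - b) ^+ 2 * q = 1 by rewrite expr2 -mulrA E1 E2.
have -> : 4 * q - b = - (b / 3) by lra.
rewrite qE sqrrN => E3; have b3 : 0 <= b / 3 by move: b0; lra.
have : (b / 3) ^+ 2 <= 1 by rewrite expr_le1 //; move: b1; lra.
move=> /(ler_wpM2r (_ : 0 <= b / 6)); rewrite E3 => H.
by have := H ltac:(by move: b0; lra); move: b1; lra.
Qed.

Lemma quartic_defining x : frontier quartic_domain x ->
  defining_function quartic_domain x quartic.
Proof.
move=> fx; pose G y := dotv (grad quartic y) (grad quartic y).
have pG : polynomial_fun G.
  apply: polynomial_sum => i; have pi : polynomial_fun (fun y => grad quartic y 0 i).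
    rewrite (_ : (fun y => _) = partial i quartic).
      by apply: polynomial_partial; exact: quartic_poly.
    by apply/funext => y; rewrite mxE.
  exact: polynomialM.
have oG : open [set y | 0 < G y].
  rewrite (_ : [set y | 0 < G y] = G @^-1` [set r | 0 < r]) //.
  apply: open_comp => [y _|]; last exact: open_gt.
  exact/differentiable_continuous/polynomial_differentiable.
exists [set y | 0 < G y]; split=> //.
- split=> //=; rewrite dotv_gt0; apply: grad_quartic_neq0.
  exact: quartic_frontier.
- exact/polynomial_smooth/quartic_poly.
- by move=> y /=; rewrite dotv_gt0.
Qed.

Lemma offset_sqr x : dotv x x = 64 + 16 * offset x 0 o + sqdist x.
Proof.
have H (u : 'rV[R]_d) : dotv (u + 8 *: e) (u + 8 *: e) = 64 + 16 * u 0 o + dotv u u.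
  rewrite dotvDl !dotvDr !dotvZl !dotvZr (dotvC e) !dotv_delta.
  by rewrite [e 0 o]mxE !eqxx /=; ring.
by rewrite -[sqdist x]/(dotv (offset x) (offset x)) -H subrK.
Qed.

(** It suffices that [k (x . grad) <= (4 q - b) |x|^2].  On the boundary
    [w_o = q^2 - b q / 2] and [|x|^2 = 64 + 16 w_o + q], and the difference of
    the two sides is
    [(4 q - b) (64 + (16 - 8 k) w_o + q) + k (8 + b q / 2 - 3 q^2)].  Its first
    term is negative only for [q < b / 4], where it is at least [- 65 b] while
    the second is at least [7 k], and [65 b <= 7 k]. *)
Lemma quartic_boundary_form (k : R) x : 0 < k -> k < 1 -> b <= k / 10 ->
  frontier quartic_domain x -> boundary_form k quartic x.
Proof.
move=> k0 k1 bk fx X _; have qx := quartic_frontier fx.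
have qb : sqdist x <= 11 / 10 by apply: sqdist_bound; rewrite qx.
have q0 : 0 <= sqdist x by exact: dotv_ge0.
have wq := sqr_coord_le (offset x) o; rewrite -/(sqdist x) in wq.
have xN : dotv x (grad quartic x) =
    (4 * sqdist x - b) * (8 * offset x 0 o + sqdist x) - 8 - offset x 0 o.
  have H (u : 'rV[R]_d) c :
      dotv (u + 8 *: e) (c *: u - e) = c * (8 * u 0 o + dotv u u) - 8 - u 0 o.
    rewrite dotvDr dotvNr !dotvDl !dotvZl !dotvZr (dotvC e) !dotv_delta.
    by rewrite [e 0 o]mxE !eqxx /=; ring.
  by rewrite grad_quartic -[sqdist x]/(dotv (offset x) (offset x)) -H subrK.
have xx : 0 < dotv x x by rewrite offset_sqr; nra.
rewrite hess_quartic.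
apply: (@le_trans _ _ ((4 * sqdist x - b) * dotv X X)); last first.
  by rewrite lerDr mulr_ge0 // sqr_ge0.
rewrite ler_wpM2r ?dotv_ge0 // mulrA ler_pdivrMr // xN offset_sqr.
move: qx; rewrite /quartic.
move: (sqdist x) (offset x 0 o) qb q0 wq => q w qb q0 wq qx.
have w2 : w <= 11 / 10 by nra.
have w3 : - (11 / 10) <= w by nra.
have wE : w = q ^+ 2 - b / 2 * q by lra.
have T0 : 0 <= 64 + (16 - 8 * k) * w + q by nra.
have q2 : 3 * q ^+ 2 <= 4 by rewrite expr2; nra.
have bq : 0 <= b * q by rewrite mulr_ge0.
have S : 4 * k <= k * (8 + b / 2 * q - 3 * q ^+ 2).
  by rewrite (mulrC 4) ler_wpM2l ?ltW //; lra.
suff : 0 <= (4 * q - b) * (64 + (16 - 8 * k) * w + q)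
    + k * (8 + b / 2 * q - 3 * q ^+ 2).
  have : k * w = k * q ^+ 2 - k * (b / 2 * q) by rewrite wE; ring.
  lra.
have [h|h] := leP b (4 * q).
  by rewrite addr_ge0 // ?mulr_ge0 ?subr_ge0 //; lra.
have q4 : q < 1 / 40 by lra.
have w0 : w <= 0 by rewrite wE expr2; nra.
have q5 : 3 * q ^+ 2 <= 1 by rewrite expr2; nra.
have S' : 7 * k <= k * (8 + b / 2 * q - 3 * q ^+ 2).
  by rewrite (mulrC 7) ler_wpM2l ?ltW //; lra.
have : (b - 4 * q) * (64 + (16 - 8 * k) * w + q) <= b * 65.
  by apply: ler_pM => //; nra.
lra.
Qed.

End QuarticDomain.

Section QuarticTopology.
Context {R : realType} {d : nat}.
Variables (o : 'I_d) (b : R).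
Hypotheses (b0 : 0 <= b) (b1 : b <= 1 / 10).
Implicit Types (x y u v : 'rV[R]_d).

Let e : 'rV[R]_d := delta_mx 0 o.
Let Om := quartic_domain o b.
Let level u : R := dotv u u ^+ 2 - b / 2 * dotv u u - u 0 o.

Let OmE u : Om (u + 8 *: e) <-> level u < 0.
Proof. by rewrite /Om /quartic_domain /= /quartic /sqdist /offset addrK. Qed.

Let segE x y (t : R) : let u := offset o x in let v := offset o y in
  x + t *: (y - x) = (u + t *: (v - u)) + 8 *: e.
Proof. by move=> u v; apply/rowP => i; rewrite !mxE; ring. Qed.

Let dotv_seg u v (t : R) : dotv (u + t *: (v - u)) (u + t *: (v - u)) =
  (1 - t) ^+ 2 * dotv u u + 2 * t * (1 - t) * dotv u v + t ^+ 2 * dotv v v.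
Proof.
rewrite !(dotvDl, dotvDr, dotvZl, dotvZr, dotvNl, dotvNr) (dotvC v u); ring.
Qed.

Let dotv_seg_le u v (t : R) : 0 <= t <= 1 ->
  dotv (u + t *: (v - u)) (u + t *: (v - u)) <= (1 - t) * dotv u u + t * dotv v v.
Proof.
move=> /andP[t0 t1]; rewrite dotv_seg.
have : 0 <= dotv (u - v) (u - v) by exact: dotv_ge0.
rewrite !(dotvDl, dotvDr, dotvNl, dotvNr) (dotvC v u).
move: (dotv u u) (dotv u v) (dotv v v) => A B C H.
have : 0 <= t * (1 - t) * (A + - B + (- B - - C)) by rewrite !mulr_ge0 // subr_ge0.
lra.
Qed.

Let seg0 u v (t : R) : (u + t *: (v - u)) 0 o = (1 - t) * u 0 o + t * v 0 o.
Proof. by rewrite !mxE; ring. Qed.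

Lemma quartic_domain_bounded : bounded_set Om.
Proof.
exists (8 * `|e| + 2); split; first exact: num_real.
move=> M hM x Ox; apply: le_trans (ltW hM).
have qb : sqdist o x <= 11 / 10 by exact: (sqdist_bound b1 (ltW Ox)).
rewrite -(subrK (8 *: e) x) (le_trans (ler_normD _ _)) // addrC lerD //.
  by rewrite normrZ ger0_norm.
rewrite [leLHS]/Num.Def.normr /= mx_normrE; apply: bigmax_le => // -[i j] _ /=.
rewrite ord1; have := sqr_coord_le (offset o x) j; rewrite -/(sqdist o x).
rewrite -real_normK ?num_real // => H.
rewrite leNgt; apply/negP => H2; move: H H2 qb; rewrite expr2.
by move: (sqdist o x) (`|_|) => q r; nra.
Qed.

Lemma quartic_domain_origin : (~` closure Om) 0.
Proof.
move=> /quartic_closure; rewrite /quartic /sqdist /offset sub0r.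
rewrite dotvNl dotvNr opprK dotvZl dotvZr dotv_delta !mxE !eqxx /=.
by move: b1; lra.
Qed.

Let seg_continuous x y : continuous (fun t : R => x + t *: (y - x)).
Proof.
move=> t; apply: differentiable_continuous; apply/derivable1_diffP.
have := is_derive_parabola x (y - x) 0 t; rewrite scaler0 addr0.
have -> : (fun s : R => x + s *: (y - x) + s ^+ 2 *: 0) =
    (fun s => x + s *: (y - x)).
  by apply/funext => s; rewrite scaler0 addr0.
by case.
Qed.

Let seg_component x y :
  (forall t : R, 0 <= t <= 1 -> Om (x + t *: (y - x))) ->
  connected_component Om x y.
Proof.
move=> H; pose S := (fun t : R => x + t *: (y - x)) @` `[0, 1]%classic.
have cS : connected S.
  apply: connected_continuous_connected; first exact: segment_connected.
  by apply: continuous_subspaceT; exact: seg_continuous.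
have Sx : S x by exists 0; rewrite ?scale0r ?addr0 //= in_itv /= lexx ler01.
have Sy : S y by exists 1; rewrite ?scale1r ?subrKC //= in_itv /= lexx ler01.
apply: (connected_component_max Sx _ cS) Sy => z [t /=].
by rewrite in_itv /= => t01 <-; exact: H.
Qed.

Let p : 'rV[R]_d := 2^-1 *: e + 8 *: e.

Let ee : e 0 o = 1. Proof. by rewrite mxE !eqxx. Qed.

Let offp : offset o p = 2^-1 *: e. Proof. by rewrite /offset addrK. Qed.

Let dpp : dotv (2^-1 *: e) (2^-1 *: e) = 1 / 4.
Proof. by rewrite dotvZl dotvZr dotv_delta ee; field. Qed.

(** With [q = |w|^2] the defining function is [q^2 - b q / 2 - w_o].  Along the
    segment to [p], past its initial point, [w_o > 0], so that only the part
    [q > b / 2] matters, and there [q^2 - b q / 2] is an increasing convex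
    function of [q]. *)
Let seg_to_center x : Om x -> 0 <= offset o x 0 o ->
  forall t : R, 0 <= t <= 1 -> Om (x + t *: (p - x)).
Proof.
move=> Ox w0 t t01; have [->|tN] := eqVneq t 0; first by rewrite scale0r addr0.
rewrite segE offp; apply/OmE.
have Lx : level (offset o x) < 0 by exact: Ox.
have := dotv_seg_le (offset o x) (2^-1 *: e) t01.
have := dotv_ge0 (offset o x).
have := dotv_ge0 (offset o x + t *: (2^-1 *: e - offset o x)).
move: Lx; rewrite /level seg0 dpp.
have -> : (2^-1 *: e) 0 o = 2^-1 by rewrite mxE ee mulr1.
move: w0; move: (dotv (_ + _) _) (dotv (offset o x) _) (offset o x 0 o).
move=> Q q w w0 Lx Q0 q0; set S := (1 - t) * q + t * (1 / 4) => QS.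
have /andP[t0 t1] := t01.
have tp : 0 < t by rewrite lt_def tN.
have [Qb|Qb] := leP Q (b / 2).
  have : Q * (Q - b / 2) <= 0 by rewrite mulr_ge0_le0 // subr_le0.
  have : 0 <= (1 - t) * w by rewrite mulr_ge0 // subr_ge0.
  lra.
have mono : 0 <= (S - Q) * (S + Q - b / 2).
  by rewrite mulr_ge0 // ?subr_ge0 // (le_trans (ltW Qb)) // lerDr (le_trans Q0).
have conv : 0 <= t * (1 - t) * (q - 1 / 4) ^+ 2.
  by rewrite mulr_ge0 ?sqr_ge0 // mulr_ge0 //; lra.
have h1 : 0 <= (1 - t) * (w - (q ^+ 2 - b / 2 * q)).
  by rewrite mulr_ge0 //; lra.
have h2 : 0 <= t * b by rewrite mulr_ge0.
rewrite /S in mono; lra.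
Qed.

(** The part of the domain in [w_o < 0] is a thin sliver; moving in the
    direction [e] up to [w_o = 0] stays inside because the defining function
    has derivative close to [- 1] in that direction. *)
Let raise_coord x : Om x -> offset o x 0 o < 0 ->
  forall t : R, 0 <= t <= 1 ->
    Om (x + t *: ((x - offset o x 0 o *: e) - x)).
Proof.
move=> Ox; have qb := sqdist_bound b1 (ltW Ox).
have wq := sqr_coord_le (offset o x) o; rewrite -/(sqdist o x) in wq.
have Lx : level (offset o x) < 0 by exact: Ox.
move=> w0 t /andP[t0 t1].
have -> : x + t *: (x - offset o x 0 o *: e - x) =
    (offset o x - (t * offset o x 0 o) *: e) + 8 *: e.
  move: (offset o x 0 o) => w; apply/rowP => i; rewrite !mxE; ring.
apply/OmE; have q0 := dotv_ge0 (offset o x).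
have Q0 := dotv_ge0 (offset o x - (t * offset o x 0 o) *: e).
have QE : dotv (offset o x - (t * offset o x 0 o) *: e)
    (offset o x - (t * offset o x 0 o) *: e) =
    dotv (offset o x) (offset o x)
      - (2 * t - t ^+ 2) * offset o x 0 o ^+ 2.
  move: (offset o x) => u.
  rewrite dotvDl dotvNl !dotvDr !dotvNr !dotvZl !dotvZr (dotvC e) !dotv_delta ee.
  by ring.
have wE : (offset o x - (t * offset o x 0 o) *: e) 0 o =
    (1 - t) * offset o x 0 o.
  move: (offset o x) => u; rewrite 3!mxE ee; ring.
move: Lx w0 qb wq Q0 q0; rewrite /level QE wE /sqdist.
move: (dotv _ _) (offset o x 0 o) => q w Lx w0 qb wq Q0 q0.
have wb : - w <= 11 / 10 by nra.
have h1 : 0 <= (2 - t) * (- w) by rewrite mulr_ge0 //; lra.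
have h2 : (2 - t) * (- w) <= 2 * (11 / 10).
  by rewrite ler_pM //; lra.
have h3 : - (1 / 20) <= (q - (2 * t - t ^+ 2) * w ^+ 2) + q - b / 2.
  by move: b1; lra.
have h4 : 0 <= 1 + (2 - t) * (- w) *
    ((q - (2 * t - t ^+ 2) * w ^+ 2) + q - b / 2) by nra.
have : t * w * (1 + (2 - t) * (- w) *
    ((q - (2 * t - t ^+ 2) * w ^+ 2) + q - b / 2)) <= 0.
  by rewrite mulr_le0_ge0 // mulr_ge0_le0 // ltW.
move: Lx; lra.
Qed.

Lemma quartic_domain_connected : connected Om.
Proof.
suff -> : Om = connected_component Om p by exact: component_connected.
apply/seteqP; split=> [x Ox|]; last exact: connected_component_sub.
apply: connected_component_sym.
have [w0|w0] := leP 0 (offset o x 0 o).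
  by apply: seg_component; exact: seg_to_center.
have xm := seg_component (raise_coord Ox w0).
apply: connected_component_trans xm _.
apply: seg_component; apply: seg_to_center.
  have := raise_coord Ox w0 (t := 1); rewrite scale1r subrKC; apply.
  by rewrite ler01 lexx.
rewrite (_ : offset o (x - _) = offset o x - offset o x 0 o *: e).
  by move: (offset o x) => u; rewrite 3!mxE ee mulr1 subrr.
by rewrite /offset addrAC.
Qed.

Lemma quartic_bounded_domain : bounded_domain Om.
Proof.
split.
- exists p; rewrite /p; apply/OmE; rewrite /level dpp mxE ee.
  by move: b0; lra.
- exact: quartic_domain_open.
- exact: quartic_domain_connected.
- exact: quartic_domain_bounded.
- by move=> x fx; exists (quartic o b); exact: (quartic_defining b0 b1).
Qed.

Lemma quartic_II_lower_bound (alpha : R) : 0 < alpha -> alpha < 1 ->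
  b <= (1 - alpha) / 10 -> II_lower_bound alpha Om.
Proof.
move=> a0 a1 ba; have [_ oO _ _ sO] := quartic_bounded_domain.
apply/II_lower_boundP => // x fx; exists (quartic o b).
  exact: (quartic_defining b0 b1).
by apply: (quartic_boundary_form b0 b1) => //; lra.
Qed.

Lemma quartic_domain_convex : b = 0 -> convex_set Om.
Proof.
move=> bE; apply/convex_setP => x y Ox Oy t t01; rewrite segE; apply/OmE.
have Lx : level (offset o x) < 0 by exact: Ox.
have Ly : level (offset o y) < 0 by exact: Oy.
have := dotv_seg_le (offset o y) (offset o x) t01.
have := dotv_ge0 (offset o y + t *: (offset o x - offset o y)).
move: Lx Ly; rewrite /level seg0 bE mul0r !mul0r !subr0.
move: (dotv (_ + _) _) (dotv _ _) (dotv _ _) (offset o x 0 o) (offset o y 0 o).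
move=> Q q2 q1 w1 w2 L1 L2 Q0 Qq; case/andP: t01 => t0 t1.
have : Q ^+ 2 <= ((1 - t) * q2 + t * q1) ^+ 2 by rewrite ler_pXn2r ?nnegrE //; lra.
have : 0 <= t * (1 - t) * (q1 - q2) ^+ 2
  by rewrite mulr_ge0 ?sqr_ge0 // mulr_ge0 //; lra.
have [->|tN] := eqVneq t 0; first by lra.
have : 0 < t * (w1 - q1 ^+ 2) by rewrite mulr_gt0 ?lt_def ?tN //; lra.
have : 0 <= (1 - t) * (w2 - q2 ^+ 2) by rewrite mulr_ge0 //; lra.
lra.
Qed.


(** The points [w = (b / 2) e_j] and [w = - (b / 2) e_j] lie in the domain; their
    midpoint [w = 0] lies on the boundary. *)
Lemma quartic_domain_nonconvex (j : 'I_d) : j != o -> 0 < b -> ~ convex_set Om.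
Proof.
move=> oo bp /convex_setP H.
have L (s : R) : s ^+ 2 = b ^+ 2 / 4 -> Om (s *: delta_mx 0 j + 8 *: e).
  move=> sE; apply/OmE; rewrite /level.
  have -> : (s *: delta_mx 0 j : 'rV[R]_d) 0 o = 0.
    by rewrite !mxE (eq_sym o) (negbTE oo) andbF mulr0.
  rewrite dotvZl dotvZr dotv_delta mxE !eqxx /= mulr1 -expr2 sE.
  have b2 : 0 < b ^+ 2 by rewrite exprn_gt0.
  rewrite subr0 expr2 -mulrBl pmulr_llt0 ?divr_gt0 //.
  by rewrite subr_lt0 expr2; move: b1; nra.
have := H _ _ (L (b / 2) _) (L (- (b / 2)) _) 2^-1.
rewrite (_ : _ + 2^-1 *: _ = 0 + 8 *: e); last first.
  by apply/rowP => i; rewrite !mxE; field.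
have h (s : R) : s = b / 2 \/ s = - (b / 2) -> s ^+ 2 = b ^+ 2 / 4.
  by case=> ->; rewrite ?sqrrN; field.
move=> /(_ (h _ (or_introl erefl)) (h _ (or_intror erefl))) Hm.
have /OmE : Om (0 + 8 *: e) by apply: Hm; lra.
by rewrite /level dotv0l mxE expr0n /= mulr0 !subr0 ltxx.
Qed.

End QuarticTopology.

Theorem proposition1p3 (R : realType) (d : nat) (alpha : R)
    (hd : (3 <= d)%N) (halpha0 : 0 < alpha) (halpha1 : alpha < 1) :
  (forall Omega : set 'rV[R]_d,
     bounded_domain Omega -> II_lower_bound alpha Omega -> Omega 0 ->
     convex_set Omega)
  /\
  ((exists Omega : set 'rV[R]_d,
      [/\ bounded_domain Omega, (~` closure Omega) 0,
          II_lower_bound alpha Omega & convex_set Omega])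
   /\
   (exists Omega : set 'rV[R]_d,
      [/\ bounded_domain Omega, (~` closure Omega) 0,
          II_lower_bound alpha Omega & ~ convex_set Omega])).
Proof.
split; first by move=> Omega; exact: interior_origin_convex.
pose o : 'I_d := Ordinal (leq_trans (isT : (0 < 3)%N) hd).
pose j : 'I_d := Ordinal (leq_trans (isT : (1 < 3)%N) hd).
split.
  have z1 : (0 : R) <= 1 / 10 by lra.
  exists (quartic_domain o 0); split.
  - exact: quartic_bounded_domain.
  - exact: quartic_domain_origin.
  - by apply: quartic_II_lower_bound => //; lra.
  - exact: quartic_domain_convex.
pose b := (1 - alpha) / 10.
have b0 : 0 < b by rewrite /b; lra.
have b1 : b <= 1 / 10 by rewrite /b; lra.
exists (quartic_domain o b); split.
- exact: quartic_bounded_domain (ltW b0) b1.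
- exact: quartic_domain_origin.
- by apply: quartic_II_lower_bound => //; exact: ltW.
- exact: (@quartic_domain_nonconvex _ _ o b b1 j).
Qed.
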